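(* Let $G=G_N=(V,E)$ be finite connected undirected graphs on $N$ vertices, and assume that there are finite constants $\delta,\delta'>0$, independent of $N$, such that $\frac{\delta}{N}\le \pi_N(v)\le \frac{\delta'}{N}$ for all $v\in V$ and all $N\ge 1$. Let $(A(t))_{t\ge0}$ be an IDLA process on $G\times\mathbb{Z}$ starting from the flat configuration $A(0)=R_0$. Suppose that $T=T(N)\le N^m$ for some finite $m\in\mathbb{N}$. Then for any $\gamma>0$ there exists a constant $C_{\gamma,m}$, depending only on $\gamma,\delta,\delta',m$, such that $$\mathbb{P}\Big(R_{\frac{T}{N}-C_{\gamma,m}\sqrt{\tau_N}(\log N)^2}\subseteq A(T)\subseteq R_{\frac{T}{N}+C_{\gamma,m}\sqrt{\tau_N}(\log N)^2}\Big)\ge 1-N^{-\gamma}$$ for $N$ large enough.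
   Context: Graph: $\mathbb{G}=G\times\mathbb{Z}$ has vertex set $\mathbb{V}=\{(v,y): v\in V,\ y\in\mathbb{Z}\}$, with $(v,y)$ adjacent to $(v',y')$ iff ($v\sim v'$ in $G$ and $y=y'$) or ($v=v'$ and $|y-y'|=1$). Level $y$ is $G\times\{y\}$, and for real $y$, $R_y=\{(v,k)\in\mathbb{V}: k\le y\}$. For $v\in V$, $\pi_N(v)=\deg v/(2|E|)$. Simple random walk on $\mathbb{G}$: a discrete-time Markov chain which at each step makes a vertical move with probability $1/2$ and a horizontal move with probability $1/2$. A vertical move goes from $(v,y)$ to $(v,y+1)$ or $(v,y-1)$ with equal probability. A horizontal move is a lazy simple random walk step on $G$: $(v,y)\to(v,y)$ with probability $1/2$ and $(v,y)\to(w,y)$ with probability $1/(2\deg v)$ for each neighbour $w$ of $v$. IDLA on $\mathbb{G}$ from $A(0)$: at each time $t\ge1$ an independent simple random walk on $\mathbb{G}$ is started at a location $(v,0)$ with $v$ sampled from $\pi_N$, and $A(t)=A(t-1)\cup\{Z_t\}$, where $Z_t$ is the first vertex outside $A(t-1)$ visited by this walk. Here $T=T(N)$ is a (nonnegative integer) number of steps. Mixing time: let $P^k_v$ be the law at time $k$ of the lazy simple random walk on $G$ (holding with probability $1/2$, otherwise moving to a uniform neighbour) started at $v$. For $\varepsilon>0$, $\tau_N(\varepsilon)=\inf\{k\ge0:\max_{v,v'\in V}\|P^k_v-P^k_{v'}\|_{TV}\le\varepsilon\}$, and $\tau_N=\tau_N(1/2)$, where $\|\mu-\nu\|_{TV}=\sup_{B}|\mu(B)-\nu(B)|$.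 *)

(* Defs.v *)
From HB Require Import structures.
From mathcomp Require Import all_boot all_order all_algebra.
From mathcomp Require Import all_classical all_reals all_analysis.

Set Implicit Arguments.
Unset Strict Implicit.
Unset Printing Implicit Defensive.

Import Order.TTheory GRing.Theory Num.Theory.

Local Open Scope classical_set_scope.
Local Open Scope ring_scope.

Record sgraph := SGraph {
  vertex :> finType;
  adj : rel vertex;
  adj_sym : symmetric adj;
  adj_irr : irreflexive adj }.

Arguments adj {s}.

Definition connected_graph (G : sgraph) : Prop :=
  forall v w : G, connect adj v w.

Definition edges (G : sgraph) : {set {set G}} :=
  [set B : {set G} | [exists v, exists w, adj v w && (B == [set v; w])]]%SET.

Definition deg (G : sgraph) (v : G) : nat := #|[set w | adj v w]%SET|.

Definition piN (R : realType) (G : sgraph) (v : G) : R :=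
  (deg v)%:R / (2 * #|edges G|)%:R.

Definition lazy_step (R : realType) (G : sgraph) (v w : G) : R :=
  if w == v then 2^-1
  else if adj v w then (2 * (deg v)%:R)^-1 else 0.

Fixpoint lazy_law (R : realType) (G : sgraph) (k : nat) (v w : G) : R :=
  if k is k'.+1 then \sum_(u : G) lazy_law R k' v u * lazy_step R u w
  else (w == v)%:R.

(* The supremum over events is a maximum since V is finite; the value 0 is
   attained at the empty event, so it can serve as default. *)
Definition tv_dist (R : realType) (V : finType) (mu nu : V -> R) : R :=
  \big[Num.max/0]_(B : {set V}) `|\sum_(v in B) mu v - \sum_(v in B) nu v|.

(* On a connected graph the lazy walk is aperiodic, so for eps > 0 the infimum
   is over a nonempty set and the default value of [inf] plays no role. *)
Definition mixing_time (R : realType) (G : sgraph) (eps : R) : R :=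
  inf [set k%:R | k in [set k : nat |
    \big[Num.max/0]_(v : G) \big[Num.max/0]_(v' : G)
      tv_dist (lazy_law R k v) (lazy_law R k v') <= eps]].

Definition half_cylinder (R : realType) (G : sgraph) (y : R) : set (G * int) :=
  [set z | z.2%:~R <= y].

Definition cyl_step (R : realType) (G : sgraph) (x z : G * int) : R :=
  2^-1 * (if (z.1 == x.1) && ((z.2 == x.2 + 1) || (z.2 == x.2 - 1))
          then 2^-1 else 0)
  + 2^-1 * (if z.2 == x.2 then lazy_step R x.1 z.1 else 0).

Definition cyl_start (R : realType) (G : sgraph) (x : G * int) : R :=
  if x.2 == 0 then piN R x.1 else 0.

Section Processes.
Context (R : realType) (d : measure_display) (Omega : measurableType d).
Context (P : probability Omega R).

(* Markov chain with values in a countable discrete space S.  The Markov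
   property
     P(X_{n+1} = x_{n+1} | X_0 = x_0, ..., X_n = x_n) = p(x_n, x_{n+1})
   is multiplied out to avoid conditioning on null events. *)
Definition markov_chain (S : Type) (mu : S -> R) (p : S -> S -> R)
    (X : nat -> Omega -> S) : Prop :=
  [/\ forall k x, measurable (X k @^-1` [set x]),
      forall x, P (X 0%N @^-1` [set x]) = (mu x)%:E
    & forall n (x : nat -> S),
        P [set w | forall k, (k <= n.+1)%N -> X k w = x k] =
        (P [set w | forall k, (k <= n)%N -> X k w = x k]
         * (p (x n) (x n.+1))%:E)%E].

Definition generated_sigma (S : Type) (X : nat -> Omega -> S) :
    set (set Omega) :=
  <<s [set B | exists k x, B = X k @^-1` [set x]] >>.

Definition mutually_independent (F : nat -> set (set Omega)) : Prop :=
  forall (J : seq nat) (B : nat -> set Omega), uniq J ->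
    (forall j, j \in J -> F j (B j)) ->
    P (\bigcap_(j in [set` J]) B j) = (\prod_(j <- J) P (B j))%E.

Definition first_exit (S : Type) (A : set S) (x : nat -> S) : set S :=
  [set z | exists n, [/\ x n = z, ~ A z & forall k, (k < n)%N -> A (x k)]].

(* [X t] is the walk released at time t + 1.  [first_exit] is the singleton
   of the first vertex visited outside the aggregate; it is empty if the walk
   never leaves the aggregate, which has probability 0 when the aggregate is a
   half cylinder plus finitely many vertices. *)
Definition IDLA (G : sgraph) (A0 : set (G * int))
    (A : nat -> Omega -> set (G * int)) : Prop :=
  exists X : nat -> nat -> Omega -> G * int,
  [/\ forall t, markov_chain (@cyl_start R G) (@cyl_step R G) (X t),
      mutually_independent (fun t => generated_sigma (X t)),
      forall w, A 0%N w = A0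
    & forall t w, A t.+1 w = A t w `|` first_exit (A t w) (fun k => X t k w)].

End Processes.

(* Main.v *)
(** Mixing.  The horizontal walk halves oscillations in [tau] steps; comparison
    with the supersolution [(1 - 1 / (2 sqrt tau)) ^ j] shows that the law of
    the first visit to the level [j] steps higher is within
    [2 (1 - 1 / (2 sqrt tau)) ^ j] of [piN], so that [L ~ sqrt tau * ln N] levels
    are enough to mix.

    Inner bound.  For a target [z = (v, y)] let [h x] be the probability that the
    walk from [x] first hits level [y] at [z], extended by 0 above that level.
    As long as [z] is vacant, the products of [1 + (piN v - h) / 2] over the
    settled sites form a supermartingale.  A particle settled far below [y]
    contributes a factor close to 1, the [O(L)] levels below [y] cost at most
    [expR (O(L))], and every particle settled at or above level [y] gains
    [1 + piN v / 2].  If [t >= N (y + w)] there are at least [N w] of the latter,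
    hence [z] is vacant at time [t] with probability [expR (O(L) - c w)].  The
    fluctuation does not depend on [t], since low sites do not contribute.

    Outer bound.  If all levels below [t / N - w] are filled, at most [N (w + 1)]
    particles lie above, so among [O(w)] consecutive levels there is one of which
    the aggregate occupies at most half of the [piN]-mass.  A walk that has mixed
    since the last sparse level crosses the next one inside the aggregate with
    probability at most 3/4, so [O(ln N)] blocks of [O(L + w)] levels suffice. *)

Require Import Defs.
From HB Require Import structures.
From mathcomp Require Import all_boot all_order all_algebra.
From mathcomp Require Import all_classical all_reals all_analysis.
From mathcomp Require Import ring lra zify.

Set Implicit Arguments.
Unset Strict Implicit.
Unset Printing Implicit Defensive.

Import Order.TTheory GRing.Theory Num.Theory.
Import numFieldNormedType.Exports.

Local Open Scope classical_set_scope.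
Local Open Scope ring_scope.

(** * Elementary inequalities and counting *)

Section ElementaryEstimates.
Context (R : realType).

Lemma bernoulli_ineq (y : R) n : 0 <= y -> y <= 1 -> 1 - n%:R * y <= (1 - y) ^+ n.
Proof.
move=> y0 y1; elim: n => [|n IH]; first by rewrite mul0r subr0 expr0.
rewrite exprS; apply: (@le_trans _ _ ((1 - y) * (1 - n%:R * y))).
  rewrite -natr1; have : 0 <= n%:R * y * y by rewrite !mulr_ge0.
  nra.
by rewrite ler_wpM2l// subr_ge0.
Qed.

Lemma expR_half_le (a : R) : 0 <= a -> a <= 1 -> expR (a / 2) <= 1 + a.
Proof.
move=> a0 a1; have := expR_ge1Dx (- (a / 2)); rewrite expRN => h.
have e0 := expR_gt0 (a / 2).
have h2 : (1 + - (a / 2)) * expR (a / 2) <= 1.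
  by rewrite -ler_pdivlMr// mul1r.
have : 1 <= (1 + - (a / 2)) * (1 + a) by nra.
have : 0 < 1 + - (a / 2) by lra.
move=> p h3; rewrite -(ler_pM2l p); exact: le_trans h3.
Qed.

Lemma expRN_le (a : R) : 0 <= a -> a <= 1 -> expR (- a) <= 1 - a / 2.
Proof.
move=> a0 a1; have := expR_ge1Dx a; rewrite expRN => h.
have e0 := expR_gt0 a.
rewrite -[leLHS]mul1r ler_pdivrMr//.
have : 1 <= (1 - a / 2) * (1 + a) by nra.
move/le_trans; apply; rewrite ler_wpM2l//; lra.
Qed.

Lemma expR1_le4 : expR 1 <= 4 :> R.
Proof.
have h : expR (1 / 2 : R) <= 1 + 1 by exact: expR_half_le.
have -> : (1 : R) = 1 / 2 + 1 / 2 by lra.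
rewrite expRD; have := expR_ge0 (1 / 2 : R); nra.
Qed.

Lemma nat_ceil (x : R) : 0 <= x -> exists n : nat, x <= n%:R <= x + 1.
Proof.
move=> x0; exists (Num.truncn x).+1; have /andP[h1 h2] := truncn_itv x0.
by rewrite (ltW h2) -natr1 lerD2r.
Qed.

Lemma sum_geometric_le (r : R) m : 0 <= r -> r < 1 ->
  \sum_(i < m) r ^+ i <= (1 - r)^-1.
Proof.
move=> r0 r1; have p : 0 < 1 - r by rewrite subr_gt0.
rewrite -[leRHS]mul1r ler_pdivlMr//.
have := subrX1 r m; have : 0 <= r ^+ m by rewrite exprn_ge0.
lra.
Qed.

(** Made for sums of deviations over levels: the first [L] terms are paid at the constant price [a],
    and the rest form a geometric tail. *)
Lemma sum_le_cut (c : nat -> R) (a b r : R) (L m : nat) : 0 <= r -> r < 1 -> 0 <= b ->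
  (forall j, c j <= a) -> (forall j, c (L + j)%N <= b * r ^+ j) ->
  \sum_(j < m) c j <= a * (minn m L)%:R + b * (1 - r)^-1.
Proof.
move=> r0 r1 b0 ca cb.
have : \sum_(j < m) c j <= a * (minn m L)%:R + b * \sum_(i < m - L) r ^+ i.
  elim: m => [|m IH]; first by rewrite min0n sub0n !big_ord0 !mulr0 addr0.
  rewrite big_ord_recr /=; have [mL|Lm] := ltnP m L.
    rewrite (minn_idPl mL) (_ : (m.+1 - L = 0)%N); last by apply/eqP; rewrite subn_eq0.
    move: IH; rewrite (minn_idPl (ltnW mL)) (_ : (m - L = 0)%N); last first.
      by apply/eqP; rewrite subn_eq0 ltnW.
    by rewrite -natr1 !big_ord0; have := ca m; lra.
  rewrite subSn// big_ord_recr /=; move: IH; rewrite (minn_idPr Lm).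
  rewrite (minn_idPr (leqW Lm)); have := cb (m - L)%N; rewrite subnKC//; lra.
move/le_trans; apply; rewrite lerD2l ler_wpM2l//; exact: sum_geometric_le.
Qed.

Lemma sum_subseq_le (I : eqType) (s t : seq I) (F : I -> R) :
  uniq s -> uniq t -> {subset s <= t} -> (forall i, 0 <= F i) ->
  \sum_(x <- s) F x <= \sum_(x <- t) F x.
Proof.
move=> us ut st F0.
have p : perm_eq s [seq x <- t | x \in s].
  apply: uniq_perm; rewrite ?filter_uniq// => x; rewrite mem_filter.
  by case: (boolP (x \in s)) => // /st ->.
rewrite (perm_big _ p) big_filter [leRHS](bigID (mem s)) /= lerDl.
by apply: sumr_ge0 => x _; exact: F0.
Qed.

End ElementaryEstimates.

(** The left side counts the events of the final union bound: one per time, vertex and level for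
    vacant sites, and one per particle for jumps. *)
Lemma event_count_le (N m t : nat) : (1 < N)%N -> (t <= N ^ m)%N ->
  (t.+1 * (N * t.+1) + t <= N ^ (2 * m + 4))%N.
Proof.
move=> N1 tN; have Nm0 : (0 < N ^ m)%N by rewrite expn_gt0 (ltnW N1).
have t1 : (t.+1 <= N ^ m.+1)%N by rewrite expnS; nia.
have h1 : (t.+1 * (N * t.+1) <= N ^ (2 * m + 3))%N.
  have -> : (N ^ (2 * m + 3) = N ^ m.+1 * (N * N ^ m.+1))%N.
    by rewrite -expnS -expnD; congr (_ ^ _)%N; lia.
  by rewrite leq_mul// leq_mul.
have h2 : (t <= N ^ (2 * m + 3))%N.
  by apply: leq_trans tN _; rewrite leq_exp2l//; lia.
rewrite addnS expnS; nia.
Qed.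

(** * The lazy walk on the base graph *)

Section LazyWalk.
Context (R : realType) (G : sgraph).
Implicit Types (f g : G -> R) (u v w : G).

Definition lazy_op f v : R := \sum_(w : G) lazy_step R v w * f w.

Lemma lazy_step_ge0 v w : 0 <= lazy_step R v w.
Proof.
rewrite /lazy_step; case: ifP => _; first by rewrite invr_ge0.
by case: ifP => // _; rewrite invr_ge0 mulr_ge0.
Qed.

Lemma lazy_step_sum1 v : (0 < deg v)%N -> \sum_(w : G) lazy_step R v w = 1.
Proof.
move=> dv; rewrite (bigD1 v)//= {1}/lazy_step eqxx.
have -> : \sum_(w | w != v) lazy_step R v w =
    \sum_(w in [set w | adj v w]%SET) (2 * (deg v)%:R)^-1.
  rewrite big_mkcond [RHS]big_mkcond/=; apply: eq_bigr => w _.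
  rewrite inE /lazy_step; case: eqVneq => [->|_] //=.
  by rewrite adj_irr.
rewrite sumr_const -/(deg v) -[_ *+ deg v]mulr_natr.
have d0 : (deg v)%:R != 0 :> R by rewrite pnatr_eq0 -lt0n.
by field.
Qed.

Lemma lazy_op_le f g : (forall v, f v <= g v) ->
  forall v, lazy_op f v <= lazy_op g v.
Proof.
by move=> fg v; apply: ler_sum => w _; rewrite ler_wpM2l// lazy_step_ge0.
Qed.

Lemma lazy_opD f g v : lazy_op (fun u => f u + g u) v = lazy_op f v + lazy_op g v.
Proof. by rewrite /lazy_op -big_split/=; apply: eq_bigr => w _; rewrite mulrDr. Qed.

Lemma lazy_opZ c f v : lazy_op (fun u => c * f u) v = c * lazy_op f v.
Proof. by rewrite /lazy_op mulr_sumr; apply: eq_bigr => w _; rewrite mulrCA. Qed.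

Lemma lazy_op_cst c v : (0 < deg v)%N -> lazy_op (fun=> c) v = c.
Proof. by move=> dv; rewrite /lazy_op -mulr_suml lazy_step_sum1// mul1r. Qed.

Lemma lazy_law_iter k f v :
  \sum_(w : G) lazy_law R k v w * f w = iter k lazy_op f v.
Proof.
elim: k f => [|k IH] f /=.
  rewrite (bigD1 v)//= eqxx mul1r big1 ?addr0// => w /negbTE ->.
  by rewrite mul0r.
rewrite -iterS iterSr -IH.
under eq_bigr do rewrite mulr_suml.
rewrite exchange_big/=; apply: eq_bigr => u _.
by rewrite /lazy_op mulr_sumr; apply: eq_bigr => w _; rewrite mulrA.
Qed.

Lemma lazy_law_ge0 k v w : 0 <= lazy_law R k v w.
Proof.
elim: k w => [|k IH] w /=; first by rewrite ler0n.
by apply: sumr_ge0 => u _; rewrite mulr_ge0// lazy_step_ge0.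
Qed.

Lemma lazy_law_sum1 k v : (forall u : G, (0 < deg u)%N) ->
  \sum_(w : G) lazy_law R k v w = 1.
Proof.
move=> dg; under eq_bigr do rewrite -[lazy_law _ _ _ _]mulr1.
rewrite (lazy_law_iter k (fun=> 1)); elim: k v => //= k IH v.
have -> : iter k lazy_op (fun=> 1) = (fun=> 1) by apply/funext => u; exact: IH.
exact: lazy_op_cst.
Qed.

Lemma lazy_law_step_gt0 k v u w : 0 < lazy_law R k v u -> 0 < lazy_step R u w ->
  0 < lazy_law R k.+1 v w.
Proof.
move=> vu uw /=; rewrite (bigD1 u)//= ltr_wpDr ?mulr_gt0//.
by apply: sumr_ge0 => x _; rewrite mulr_ge0 ?lazy_law_ge0 ?lazy_step_ge0.
Qed.

Lemma lazy_law_stay_gt0 j k v w : 0 < lazy_law R k v w ->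
  0 < lazy_law R (j + k) v w.
Proof.
move=> kw; elim: j => // j IH; rewrite addSn.
by apply: lazy_law_step_gt0 IH _; rewrite /lazy_step eqxx invr_gt0.
Qed.

Lemma lazy_law_path_gt0 v p : path adj v p ->
  0 < lazy_law R (size p) v (last v p).
Proof.
elim/last_ind: p => [_|p w IH] /=; first by rewrite eqxx.
rewrite rcons_path size_rcons last_rcons => /andP[vp pw].
apply: (lazy_law_step_gt0 (IH vp)).
rewrite /lazy_step pw; case: ifP => _; rewrite invr_gt0// mulr_gt0// ltr0n.
by apply/card_gt0P; exists w; rewrite inE.
Qed.

(** Holding steps pad every path to any greater length, so the maximum of the path lengths serves
    all pairs at once. *)
Lemma lazy_law_unif_gt0 : connected_graph G ->
  exists k, forall v w, 0 < lazy_law R k v w.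
Proof.
move=> cG; have ex v w : exists k, 0 < lazy_law R k v w.
  have /connectP[p vp ->] := cG v w.
  by exists (size p); exact: lazy_law_path_gt0.
have [k Hk] : {k : G -> G -> nat | forall v w, 0 < lazy_law R (k v w) v w}.
  exists (fun v w => projT1 (cid (ex v w))) => v w.
  exact: projT2 (cid (ex v w)).
exists (\max_(v : G) \max_(w : G) k v w)%N => v w.
have kle : (k v w <= \max_(v : G) \max_(w : G) k v w)%N.
  by apply: leq_trans (leq_bigmax (F := k v) w) _; exact: (leq_bigmax v).
by rewrite -(subnK kle) lazy_law_stay_gt0.
Qed.

(** The law from [u] puts mass at least [e] on a minimiser of [f], so its mean stays below the
    maximum by [e] times the oscillation, while the mean from [w] is at least the minimum. For
    [e = 0] this says that averaging does not increase oscillations. *)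
Lemma iter_lazy_op_osc_doeblin k (e c : R) f : (forall u : G, (0 < deg u)%N) ->
  (forall v w, e <= lazy_law R k v w) -> e <= 1 ->
  (forall u w, f u - f w <= c) ->
  forall u w, iter k lazy_op f u - iter k lazy_op f w <= (1 - e) * c.
Proof.
move=> dg He e1 fc u w; rewrite -!lazy_law_iter.
pose x1 := [arg max_(x > u) f x]%O; pose x0 := [arg min_(x < u) f x]%O.
have f1 x : f x <= f x1 by rewrite /x1; case: arg_maxP => //= y _; apply.
have f0 x : f x0 <= f x by rewrite /x0; case: arg_minP => //= y _; apply.
have U : \sum_(x : G) lazy_law R k u x * f x <= f x1 - e * (f x1 - f x0).
  have eq : \sum_(x : G) lazy_law R k u x * (f x1 - f x) =
     f x1 - \sum_(x : G) lazy_law R k u x * f x.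
    under eq_bigr do rewrite mulrBr.
    by rewrite sumrB -mulr_suml lazy_law_sum1// mul1r.
  rewrite lerBrDr addrC -lerBrDr -eq (bigD1 x0)//=.
  rewrite -[leLHS]addr0 lerD// ?ler_wpM2r ?subr_ge0//.
  by apply: sumr_ge0 => x _; rewrite mulr_ge0 ?lazy_law_ge0// subr_ge0.
have L : f x0 <= \sum_(x : G) lazy_law R k w x * f x.
  rewrite -[f x0]mul1r -(lazy_law_sum1 k w dg) mulr_suml.
  by apply: ler_sum => x _; rewrite ler_wpM2l ?lazy_law_ge0.
apply: (@le_trans _ _ ((1 - e) * (f x1 - f x0))).
  rewrite mulrBl mul1r; lra.
by rewrite ler_wpM2l ?subr_ge0.
Qed.

Lemma iter_lazy_op_osc_iter k q (r c : R) f : 0 <= r ->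
  (forall g d, (forall u w, g u - g w <= d) ->
     forall u w, iter k lazy_op g u - iter k lazy_op g w <= r * d) ->
  (forall u w, f u - f w <= c) ->
  forall u w, iter (k * q) lazy_op f u - iter (k * q) lazy_op f w <= r ^+ q * c.
Proof.
move=> r0 Hk; elim: q f c => [|q IH] f c fc u w.
  by rewrite muln0 /= expr0 mul1r.
rewrite mulnS iterD exprS -mulrA; apply: Hk => {}u {}w.
exact: IH.
Qed.

Lemma sum_set_lazy_law k v (B : {set G}) :
  \sum_(w in B) lazy_law R k v w = iter k lazy_op (fun w => (w \in B)%:R) v.
Proof.
rewrite -lazy_law_iter big_mkcond/=; apply: eq_bigr => w _.
by case: ifP; rewrite ?mulr1 ?mulr0.
Qed.

(** By minorisation, blocks of [k] steps contract oscillations by [1 - e]; total variation is the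
    case of indicator functions. This makes the set of times behind [mixing_time] nonempty. *)
Lemma lazy_walk_mixes : connected_graph G -> (forall u : G, (0 < deg u)%N) ->
  exists k, forall v w, tv_dist (lazy_law R k v) (lazy_law R k w) <= 2^-1.
Proof.
move=> cG dg; have [k Hk] := lazy_law_unif_gt0 cG.
have [e [e0 e1 He]] : exists e : R,
    [/\ 0 < e, e <= 1 & forall v w, e <= lazy_law R k v w].
  exists (\big[Num.min/1]_(v : G) \big[Num.min/1]_(w : G) lazy_law R k v w).
  split.
  - by apply: lt_bigmin => // v _; apply: lt_bigmin.
  - exact: bigmin_le_id.
  - by move=> v w; rewrite (le_trans (bigmin_le_cond _ (j := v) _ _))//;
       exact: bigmin_le_cond.
have [q Hq] : exists q, (1 - e) ^+ q <= 2^-1.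
  have : `|1 - e| < 1 by rewrite ger0_norm ?subr_ge0//; lra.
  move/cvg_expr => /cvgrPdist_le /(_ 2^-1) [] // n _ /(_ n (leqnn n)).
  by rewrite /= sub0r normrN normrX ger0_norm ?subr_ge0// => h; exists n.
exists (k * q)%N => v w; apply: bigmax_le => // B _.
rewrite !sum_set_lazy_law.
have H u x : iter (k * q) lazy_op (fun w => (w \in B)%:R) u -
             iter (k * q) lazy_op (fun w => (w \in B)%:R) x <= 2^-1.
  apply: le_trans Hq; rewrite -[leRHS]mulr1.
  apply: iter_lazy_op_osc_iter; first by rewrite subr_ge0.
  - by move=> g d gd; exact: iter_lazy_op_osc_doeblin.
  - by move=> {}u {}x; case: (u \in B); case: (x \in B) => /=; lra.
by rewrite ler_norml lerNl opprB !H.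
Qed.

Lemma mixing_timeP : connected_graph G -> (forall u : G, (0 < deg u)%N) ->
  exists2 k : nat, mixing_time G (2^-1 : R) = k%:R &
    forall v w, tv_dist (lazy_law R k v) (lazy_law R k w) <= 2^-1.
Proof.
move=> cG dg.
pose p k := \big[Num.max/0]_(v : G) \big[Num.max/0]_(v' : G)
      tv_dist (lazy_law R k v) (lazy_law R k v') <= 2^-1.
have pP k : reflect (forall v w, tv_dist (lazy_law R k v) (lazy_law R k w) <= 2^-1)
                    (p k).
  apply: (iffP idP) => [pk v w|H].
    apply: le_trans pk.
    by apply: le_trans (le_bigmax _ _ v); exact: le_trans (le_bigmax _ _ w).
  by apply: bigmax_le => // v _; apply: bigmax_le.
have ex : exists k, p k.
  by have [k Hk] := lazy_walk_mixes cG dg; exists k; apply/pP.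
case: (ex_minnP ex) => k pk kmin; exists k; last exact/pP.
rewrite /mixing_time; apply/eqP; rewrite eq_le; apply/andP; split.
  apply: ge_inf; last by exists k.
  by exists 0 => _ [j _ <-].
apply: lb_le_inf; first by exists k%:R; exists k.
by move=> _ [j pj <-]; rewrite ler_nat kmin.
Qed.

(** At time 0 the laws are distinct point masses, at distance 1. *)
Lemma mixing_time_gt0 v w k : v != w ->
  tv_dist (lazy_law R k v) (lazy_law R k w) <= 2^-1 -> (0 < k)%N.
Proof.
move=> vw; case: k => // /(le_trans (le_bigmax _ _ [set v]%SET)).
rewrite !big_set1/= eqxx (negbTE vw) subr0 normr1; lra.
Qed.

(* The maximal value of a difference of expectations of a function with
   oscillation [c] is reached on the level set where the first law dominates. *)
Lemma tv_dist_osc k (c : R) f : (forall u : G, (0 < deg u)%N) ->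
  (forall v w, tv_dist (lazy_law R k v) (lazy_law R k w) <= 2^-1) ->
  (forall u w, f u - f w <= c) ->
  forall u w, iter k lazy_op f u - iter k lazy_op f w <= 2^-1 * c.
Proof.
move=> dg Hk fc u w; rewrite -!lazy_law_iter.
pose x0 := [arg min_(x < u) f x]%O.
have f0 x : f x0 <= f x by rewrite /x0; case: arg_minP => //= y _; apply.
have c0 : 0 <= c by rewrite (le_trans _ (fc u u))// subrr.
pose D x := lazy_law R k u x - lazy_law R k w x.
(* Both laws have mass 1, so subtracting the minimum of [f] changes nothing and gives each summand
   the sign of [D x]. *)
have -> : \sum_(x : G) lazy_law R k u x * f x - \sum_(x : G) lazy_law R k w x * f x
   = \sum_(x : G) D x * (f x - f x0).
  under [RHS]eq_bigr do rewrite mulrBr.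
  rewrite [RHS]sumrB -[X in _ = _ - X]mulr_suml [X in _ - X * _]sumrB.
  rewrite !lazy_law_sum1// subrr mul0r subr0 -sumrB.
  by apply: eq_bigr => x _; rewrite mulrBl.
pose B := [set x | 0 <= D x]%SET.
apply: (@le_trans _ _ (\sum_(x in B) D x * c)).
  rewrite big_mkcond [leRHS]big_mkcond /=; apply: ler_sum => x _.
  rewrite inE; case: ifPn => [Dx|]; first by rewrite ler_wpM2l.
  by rewrite -ltNge => /ltW Dx; rewrite mulr_le0_ge0// subr_ge0.
rewrite -mulr_suml ler_wpM2r//.
apply: le_trans (Hk u w); apply: le_trans (le_bigmax _ _ B).
by rewrite -sumrB ler_norm.
Qed.

(** Stationarity: the factor [deg v] cancels, so all neighbours of [w] contribute equally and
    together supply the half of [piN w] that is not held. *)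
Lemma piN_lazy_step w : \sum_(v : G) piN R v * lazy_step R v w = piN R w.
Proof.
case: (posnP (deg w)) => [dw|dw].
  rewrite /piN dw mul0r big1// => v _; rewrite /lazy_step.
  case: eqVneq => [<-|_]; first by rewrite dw mul0r mul0r.
  case: ifP => [vw|]; rewrite ?mulr0//.
  have /card_gt0P : exists x, x \in [set x | adj w x]%SET.
    by exists v; rewrite inE adj_sym.
  by rewrite -/(deg w) dw.
rewrite (bigD1 w)//= {1}/lazy_step eqxx.
have -> : \sum_(v | v != w) piN R v * lazy_step R v w =
    \sum_(v in [set v | adj w v]%SET) (2 * (2 * #|edges G|)%:R)^-1.
  rewrite big_mkcond [RHS]big_mkcond/=; apply: eq_bigr => v _.
  rewrite inE /lazy_step eq_sym adj_sym; case: eqVneq => [->|_] /=.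
    by rewrite adj_irr.
  case: ifP => [vw|_]; last by rewrite mulr0.
  have dv : (deg v)%:R != 0 :> R.
    rewrite pnatr_eq0 -lt0n; apply/card_gt0P.
    by exists w; rewrite inE adj_sym.
  by rewrite /piN !invfM; move: ((2 * #|edges G|)%N%:R^-1) => e; field.
rewrite sumr_const -/(deg w) -[_ *+ deg w]mulr_natr /piN invfM.
by move: ((2 * #|edges G|)%N%:R^-1) => e; field.
Qed.

Lemma sum_piN_lazy_op f :
  \sum_(v : G) piN R v * lazy_op f v = \sum_(v : G) piN R v * f v.
Proof.
under eq_bigr do rewrite mulr_sumr.
rewrite exchange_big/=; apply: eq_bigr => w _.
rewrite -(piN_lazy_step w) mulr_suml; apply: eq_bigr => v _.
by rewrite mulrA.
Qed.

End LazyWalk.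

(** * Hitting laws of levels *)

Section OscillationDecay.
Context (R : realType) (G : sgraph) (tau : nat).
Hypothesis deg_gt0 : forall u : G, (0 < deg u)%N.
Hypothesis tau_gt0 : (0 < tau)%N.
Hypothesis tau_mix : forall v w : G,
  tv_dist (lazy_law R tau v) (lazy_law R tau w) <= 2^-1.
Implicit Types (f g : G -> R).

(** With [e = 1 / (2 sqrt tau)] this is [1 - e ^ 2], while [level_rate] is [1 - e]. The [tau]-th
    power is still at least 1/2, so one halving per [tau] steps is at least as fast as decay at this
    rate. *)
Definition osc_rate : R := 1 - (4 * tau%:R)^-1.

Definition level_rate : R := 1 - (2 * Num.sqrt tau%:R)^-1.

Lemma tau_ge1 : 1 <= tau%:R :> R. Proof. by rewrite ler1n. Qed.

Lemma osc_rate_bounds : 3 / 4 <= osc_rate <= 1.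
Proof.
rewrite /osc_rate; have := tau_ge1; move: (tau%:R) => t t1.
have h : (4 * t)^-1 <= 4^-1 by rewrite lef_pV2 ?posrE; lra.
have h0 : 0 <= (4 * t)^-1 by rewrite invr_ge0; lra.
lra.
Qed.

Lemma sqrt_tau_ge1 : 1 <= Num.sqrt tau%:R :> R.
Proof. by rewrite -[leLHS]sqrtr1 ler_wsqrtr// tau_ge1. Qed.

Lemma level_rate_bounds : 2^-1 <= level_rate < 1.
Proof.
rewrite /level_rate; have := sqrt_tau_ge1; move: (Num.sqrt _) => t t1.
have h : (2 * t)^-1 <= 2^-1 by rewrite lef_pV2 ?posrE; lra.
have h0 : 0 < (2 * t)^-1 by rewrite invr_gt0; lra.
lra.
Qed.

(* [level_rate ^+ j] is superharmonic for the vertical walk when the horizontal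
   step shrinks oscillations by [osc_rate]. *)
Lemma level_rate_superharmonic :
  4^-1 * level_rate ^+ 2 + 4^-1 + 2^-1 * (osc_rate * level_rate) <= level_rate.
Proof.
rewrite /level_rate /osc_rate.
have t1 := sqrt_tau_ge1; have : Num.sqrt tau%:R ^+ 2 = tau%:R :> R by rewrite sqr_sqrtr.
move: (Num.sqrt _) t1 => t t1 <-.
have -> : (4 * t ^+ 2)^-1 = (2 * t)^-1 ^+ 2 by field; lra.
have h : (2 * t)^-1 <= 2^-1 by rewrite lef_pV2 ?posrE; lra.
have h0 : 0 < (2 * t)^-1 by rewrite invr_gt0; lra.
move: (_^-1) h h0 => e eh e0; nra.
Qed.

Lemma osc_rate_tau : 2^-1 <= osc_rate ^+ tau.
Proof.
have h0 : 0 <= (4 * tau%:R)^-1 :> R by rewrite invr_ge0 mulr_ge0.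
apply: le_trans (bernoulli_ineq tau h0 _).
  have t0 : tau%:R != 0 :> R by rewrite pnatr_eq0 -lt0n.
  have -> : tau%:R * (4 * tau%:R)^-1 = 4^-1 :> R by field.
  lra.
have := tau_ge1; move: (tau%:R) => t t1.
have h : (4 * t)^-1 <= 4^-1 by rewrite lef_pV2 ?posrE; lra.
lra.
Qed.

(** All iterates are controlled, not only [f]: a single lazy step need not shrink the oscillation,
    but it shifts the sequence of iterates and so gains a full factor [osc_rate] in this bound. *)
Definition osc_bound (c : R) f :=
  forall n u w, iter n (@lazy_op R G) f u - iter n (@lazy_op R G) f w <= c * osc_rate ^+ n.

Lemma iter_lazy_opD n f g : iter n (@lazy_op R G) (fun u => f u + g u) =
  (fun u => iter n (@lazy_op R G) f u + iter n (@lazy_op R G) g u).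
Proof. by elim: n => //= n ->; apply/funext => u; exact: lazy_opD. Qed.

Lemma iter_lazy_opZ n c f : iter n (@lazy_op R G) (fun u => c * f u) =
  (fun u => c * iter n (@lazy_op R G) f u).
Proof. by elim: n => //= n ->; apply/funext => u; exact: lazy_opZ. Qed.

Lemma osc_bound_lazy_op c f : osc_bound c f -> osc_bound (osc_rate * c) (lazy_op f).
Proof.
by move=> H n u w; rewrite -!iterSr [osc_rate * c]mulrC -mulrA -exprS; exact: H.
Qed.

Lemma osc_boundD c d f g : osc_bound c f -> osc_bound d g ->
  osc_bound (c + d) (fun u => f u + g u).
Proof.
move=> Hf Hg n u w; rewrite iter_lazy_opD mulrDl opprD addrACA.
by rewrite lerD// ?Hf ?Hg.
Qed.

Lemma osc_boundZ c d f : 0 <= d -> osc_bound c f ->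
  osc_bound (d * c) (fun u => d * f u).
Proof.
by move=> d0 Hf n u w; rewrite iter_lazy_opZ -mulrBr -mulrA ler_wpM2l// Hf.
Qed.

(** Each complete block of [tau] steps halves the oscillation; the constant 2 pays for the
    incomplete block, since [osc_rate ^+ tau >= 1/2]. *)
Lemma osc_bound_init f : (forall v, 0 <= f v <= 1) -> osc_bound 2 f.
Proof.
move=> f01 n u w.
have /andP[s34 s1] := osc_rate_bounds.
have s0 : 0 <= osc_rate by lra.
have fc x y : f x - f y <= 1.
  by have /andP[_ ?] := f01 x; have /andP[? _] := f01 y; lra.
rewrite (divn_eq n tau) addnC [(n %/ tau * tau)%N]mulnC.
have H : forall u w, iter (n %% tau + tau * (n %/ tau)) (@lazy_op R G) f u -
   iter (n %% tau + tau * (n %/ tau)) (@lazy_op R G) f w <= 2^-1 ^+ (n %/ tau).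
  (* The [n %% tau] leftover steps are handled by the minorisation lemma with [e = 0]. *)
  move=> {}u {}w; rewrite iterD -[leRHS]mul1r -[X in X * _](subr0 1).
  apply: iter_lazy_op_osc_doeblin => //; first by move=> *; exact: lazy_law_ge0.
  move=> {}u {}w; rewrite -[leRHS]mulr1.
  apply: iter_lazy_op_osc_iter => // g d gd.
  exact: tv_dist_osc.
apply: le_trans (H u w) _.
rewrite exprD mulrCA exprM.
apply: (@le_trans _ _ (1 * (osc_rate ^+ tau) ^+ (n %/ tau))).
  rewrite mul1r; apply: lerXn2r; rewrite ?nnegrE ?invr_ge0 ?exprn_ge0//.
  exact: osc_rate_tau.
rewrite mulrA ler_wpM2r ?exprn_ge0//.
have : osc_rate ^+ tau <= osc_rate ^+ (n %% tau).
  by rewrite ler_wiXn2l// ltnW// ltn_pmod.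
have := osc_rate_tau; lra.
Qed.

End OscillationDecay.

(** * Bounded harmonic functions below a level *)

Section HarmonicExtension.
Context (R : realType) (G : sgraph).
Implicit Types (f : G -> R) (n j : nat) (v w : G).

(* [hit_approx f n j v] is the expectation of [f] at the first visit of the walk
   on the cylinder to a level, started [j] levels below at [v], restricted to
   the event that this takes at most [n] steps. *)
Fixpoint hit_approx f n j {struct n} : G -> R :=
  match n, j with
  | _, 0%N => f
  | 0%N, _ => fun=> 0
  | n'.+1, j'.+1 => fun v =>
     4^-1 * hit_approx f n' j'.+2 v + 4^-1 * hit_approx f n' j' v
     + 2^-1 * lazy_op (hit_approx f n' j'.+1) v
  end.

Lemma hit_approx0 f n : hit_approx f n 0 = f. Proof. by case: n. Qed.

(** The recurrence says that second differences vanish, and a bounded affine sequence is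
    constant. *)
Lemma bounded_affine_cst (m : nat -> R) (c : R) : (forall j, `|m j| <= c) ->
  (forall j, m j.+1 = 4^-1 * m j.+2 + 4^-1 * m j + 2^-1 * m j.+1) ->
  forall j, m j = m 0%N.
Proof.
move=> mc rec.
have aff j : m j = m 0%N + j%:R * (m 1%N - m 0%N) /\
             m j.+1 = m 0%N + j.+1%:R * (m 1%N - m 0%N).
  elim: j => [|j [IH IH1]]; first by split; ring.
  split => //; have -> : m j.+2 = 2 * m j.+1 - m j by have := rec j; lra.
  by rewrite IH1 IH -!natr1; ring.
have d0 : m 1%N - m 0%N = 0.
  apply/eqP/contraT => d0; pose d := `|m 1%N - m 0%N|.
  have dp : 0 < d by rewrite normr_gt0.
  have c0 : 0 <= c by exact: le_trans (mc 0%N).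
  have := archi_boundP (divr_ge0 (addr_ge0 c0 c0) (ltW dp)).
  set N := Num.bound _; rewrite ltr_pdivrMr// ltNge => /negP[].
  rewrite -[N%:R]ger0_norm// -normrM.
  have -> : N%:R * (m 1%N - m 0%N) = m N - m 0%N by rewrite (aff N).1; ring.
  by rewrite (le_trans (ler_normB _ _))// lerD.
by move=> j; rewrite (aff j).1 d0 mulr0 addr0.
Qed.

Lemma lazy_op_cvg (u_ : nat -> G -> R) (l : G -> R) v :
  (forall w, (fun n => u_ n w) @ \oo --> l w) ->
  (fun n => lazy_op (u_ n) v) @ \oo --> lazy_op l v.
Proof.
move=> H; rewrite /lazy_op.
apply: (@cvg_big _ _ +%R 0 xpredT _ _ _ _ (fun w n => lazy_step R v w * u_ n w)).
  by move=> x; exact: add_continuous.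
by move=> w _; apply: cvgMr.
Qed.

(** The truncated expectations [hit_approx] increase with the number of steps; [h] is their limit
    and inherits the bounds, the recurrence and the decay of oscillations. *)
Lemma harmonic_extension f tau :
  (forall u : G, (0 < deg u)%N) -> (0 < tau)%N ->
  (forall v w, tv_dist (lazy_law R tau v) (lazy_law R tau w) <= 2^-1) ->
  (forall v, 0 <= f v <= 1) ->
  exists h : nat -> G -> R,
    [/\ h 0%N = f, forall j v, 0 <= h j v <= 1,
        forall j v, h j.+1 v = 4^-1 * h j.+2 v + 4^-1 * h j v
                               + 2^-1 * lazy_op (h j.+1) v,
        forall j, \sum_(v : G) piN R v * h j v = \sum_(v : G) piN R v * f v
      & forall j u w, h j u - h j w <= 2 * level_rate R tau ^+ j].
Proof.
move=> dg t0 mix f01.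
pose a := hit_approx f.
have aS n j v : a n.+1 j.+1 v = 4^-1 * a n j.+2 v + 4^-1 * a n j v
    + 2^-1 * lazy_op (a n j.+1) v by [].
have a01 n j v : 0 <= a n j v <= 1.
  elim: n j v => [|n IH] [|j] v /=; rewrite ?f01 ?lexx ?ler01//.
  have /andP[h1 h2] := IH j.+2 v; have /andP[h3 h4] := IH j v.
  have h5 : 0 <= lazy_op (a n j.+1) v.
    by rewrite -[leLHS](lazy_op_cst _ (dg v)) lazy_op_le// => w; case/andP: (IH j.+1 w).
  have h6 : lazy_op (a n j.+1) v <= 1.
    by rewrite -[leRHS](lazy_op_cst _ (dg v)) lazy_op_le// => w; case/andP: (IH j.+1 w).
  by rewrite aS; lra.
have amono n j v : a n j v <= a n.+1 j v.
  elim: n j v => [|n IH] [|j] v //; first by case/andP: (a01 1%N j.+1 v).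
  rewrite 2!aS; have h1 := IH j.+2 v; have h2 := IH j v.
  have h3 : lazy_op (a n j.+1) v <= lazy_op (a n.+1 j.+1) v by exact: lazy_op_le.
  by lra.
have aosc n j : osc_bound tau (2 * level_rate R tau ^+ j) (a n j).
  elim: n j => [|n IH] [|j].
  - by rewrite /a hit_approx0 expr0 mulr1; exact: osc_bound_init.
  - move=> n u w; have -> : a 0%N j.+1 = (fun u => 0 * f u).
      by apply/funext => x; rewrite mul0r.
    rewrite iter_lazy_opZ !mul0r subrr.
    have /andP[? _] := level_rate_bounds R t0.
    have /andP[? _] := osc_rate_bounds R t0.
    by rewrite !mulr_ge0 ?exprn_ge0//; lra.
  - by rewrite /a hit_approx0 expr0 mulr1; exact: osc_bound_init.
  (* The vertical moves shift the exponent of [level_rate] by one either way, and the horizontal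
     move gains [osc_rate]; [level_rate_superharmonic] absorbs the sum. *)
  - have H := osc_boundD (osc_boundD (osc_boundZ (d := 4^-1) _ (IH j.+2))
      (osc_boundZ (d := 4^-1) _ (IH j)))
      (osc_boundZ (d := 2^-1) _ (osc_bound_lazy_op (IH j.+1))).
    move=> k u w; apply: le_trans (H _ _ _ k u w) _; rewrite ?invr_ge0//.
    have /andP[? _] := level_rate_bounds R t0.
    have /andP[? _] := osc_rate_bounds R t0.
    rewrite ler_wpM2r ?exprn_ge0//; first lra.
    have := level_rate_superharmonic R t0.
    have : 0 <= level_rate R tau ^+ j by rewrite exprn_ge0//; lra.
    rewrite !exprS; move: (level_rate R tau) (_ ^+ j) (osc_rate R tau) => p q s.
    by move=> q0 H'; have := ler_wpM2r q0 H'; rewrite expr0; nra.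
pose h j v := limn (fun n => a n j v).
have hc j v : (fun n => a n j v) @ \oo --> h j v.
  apply: nondecreasing_is_cvgn.
    by apply/nondecreasing_seqP => n; exact: amono.
  by exists 1 => _ [n _ <-]; case/andP: (a01 n j v).
have h01 j v : 0 <= h j v <= 1.
  apply/andP; split.
    by apply: limr_ge; [exact: cvgP (hc j v)|near=> n; case/andP: (a01 n j v)].
  by apply: limr_le; [exact: cvgP (hc j v)|near=> n; case/andP: (a01 n j v)].
have hrec j v : h j.+1 v = 4^-1 * h j.+2 v + 4^-1 * h j v
                               + 2^-1 * lazy_op (h j.+1) v.
  have c1 : (fun n => a n.+1 j.+1 v) @ \oo --> h j.+1 v.
    by have := hc j.+1 v; rewrite -(cvg_shiftS (fun n => a n j.+1 v)).
  apply: (cvg_unique _ c1) => //; rewrite /a /=.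
  apply: cvgD; first by apply: cvgD; apply: cvgMr; exact: hc.
  by apply: cvgMr; apply: lazy_op_cvg => w; exact: hc.
have h0 : h 0%N = f.
  apply/funext => v; apply: (cvg_unique _ (hc 0%N v)) => //.
  have -> : (fun n => a n 0%N v) = fun=> f v.
    by apply/funext => n; rewrite /a hit_approx0.
  exact: cvg_cst.
exists h; split => //.
(* By stationarity the horizontal step preserves the [piN]-mean, so the means satisfy the affine
   recurrence and are bounded. *)
- pose m j := \sum_(v : G) piN R v * h j v.
  move=> j; rewrite -[in RHS]h0; apply: (@bounded_affine_cst m (\sum_(v : G) `|piN R v|)).
  + move=> i; rewrite (le_trans (ler_norm_sum _ _ _))//.
    apply: ler_sum => v _; rewrite normrM ler_piMr//.
    by have /andP[? ?] := h01 i v; rewrite ger0_norm.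
  + move=> i; rewrite /m -[X in _ + 2^-1 * X]sum_piN_lazy_op !mulr_sumr -!big_split/=.
    by apply: eq_bigr => v _; rewrite hrec; ring.
- move=> j u w; have c : (fun n => a n j u - a n j w) @ \oo --> h j u - h j w.
    by apply: cvgB; exact: hc.
  rewrite -(cvg_lim _ c)//; apply: limr_le; first exact: cvgP c.
  by near=> n; have := aosc n j 0%N u w; rewrite expr0 mulr1.
Unshelve. all: by end_near. Qed.

End HarmonicExtension.

(** * Exit laws of Markov chains *)

Section CountableSums.
Context (R : realType).
Local Open Scope ereal_scope.

Lemma esumZl (I : choiceType) (D : set I) (c : R) (f : I -> \bar R) :
  (0 <= c)%R -> (forall i, 0 <= f i) ->
  \esum_(i in D) (c%:E * f i) = c%:E * \esum_(i in D) f i.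
Proof.
have le (b : R) (g : I -> \bar R) : (0 <= b)%R -> (forall i, 0 <= g i) ->
    \esum_(i in D) (b%:E * g i) <= b%:E * \esum_(i in D) g i.
  move=> b0 g0; apply: ge_ereal_sup => _ [X [finX XD] <-].
  rewrite fsbig_finite//= -ge0_sume_distrr//.
  rewrite lee_wpmul2l ?lee_fin// -fsbig_finite//; apply: esum_ge.
  by exists X.
move=> c0 f0; apply/eqP; rewrite eq_le le//=.
have [->|cn0] := eqVneq c 0%R.
  by rewrite mul0e esum_ge0// => i _; rewrite mul0e.
have cp : (0 < c)%R by rewrite lt_neqAle eq_sym cn0.
rewrite muleC -lee_pdivlMr// muleC.
have -> : \esum_(i in D) f i = \esum_(i in D) (c^-1%:E * (c%:E * f i)).
  by apply: eq_esum => i _; rewrite muleA -EFinM mulVf// mul1e.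
by apply: le; [rewrite invr_ge0|move=> i; rewrite mule_ge0].
Qed.

Lemma exchange_esum (I J : choiceType) (A : set I) (B : set J)
    (f : I -> J -> \bar R) : (forall i j, A i -> B j -> 0 <= f i j) ->
  \esum_(i in A) \esum_(j in B) f i j = \esum_(j in B) \esum_(i in A) f i j.
Proof.
move=> f0; rewrite esum_esum// esum_esum; last by move=> j i Bj Ai; exact: f0.
apply: (@reindex_esum _ _ _ _ _ (fun k : J * I => (k.2, k.1))); split.
- by move=> [j i] [/= Bj Ai]; split.
- by move=> [j i] [j' i'] _ _ [-> ->].
- by move=> [i j] [/= Ai Bj]; exists (j, i).
Qed.

Lemma esum_finite_support (I : choiceType) (r : seq I) (f : I -> \bar R) :
  uniq r -> (forall i, 0 <= f i) -> (forall i, i \notin r -> f i = 0) ->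
  \esum_(i in [set: I]) f i = \sum_(i <- r) f i.
Proof.
move=> ur f0 fr.
have -> : \esum_(i in [set: I]) f i = \esum_(i in [set` r]) f i.
  rewrite [RHS]esum_mkcond; apply: eq_esum => i _; case: ifPn => //.
  by move=> h; rewrite fr//; apply: contra h => h; rewrite inE.
have fin : finite_set [set` r] by apply/finite_seqP; exists r.
by rewrite esum_fset// -fsbig_seq.
Qed.

Context d (T : measurableType d) (I : countType).

Lemma measurable_countable_bigcup (D : set I) (F : I -> set T) :
  (forall i, D i -> measurable (F i)) -> measurable (\bigcup_(i in D) F i).
Proof.
move=> mF; rewrite bigcup_mkcond; apply: countable_bigcupT_measurable.
  exact: countableP.
by move=> i; case: ifPn; rewrite ?inE//; exact: mF.
Qed.

Lemma measure_countable_bigcup (P : probability T R) (D : set I) (F : I -> set T) :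
  (forall i, D i -> measurable (F i)) -> trivIset D F ->
  P (\bigcup_(i in D) F i) = \esum_(i in D) P (F i).
Proof.
move=> mF tF.
pose A n := if (@pickle_inv I n) is Some i then F i else set0.
have Ap i : A (pickle i) = F i by rewrite /A pickleK_inv.
have -> : \bigcup_(i in D) F i = \bigcup_(n in pickle @` D) A n.
  apply/seteqP; split => [w [i Di Fi]|w [_ [i Di <-]]].
    by exists (pickle i); [exists i|rewrite Ap].
  by rewrite Ap => Fi; exists i.
rewrite measure_bigcup.
- rewrite nneseries_esum//.
  have -> : [set x | x \in [set (@pickle I x0) | x0 in D]] = pickle @` D.
    by apply/seteqP; split => x; rewrite /= inE.
  rewrite esum_image//; first by apply: eq_esum => i _; rewrite Ap.
  by move=> i j _ _ /(pcan_inj (@pickleK I)).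
- by move=> _ [i Di <-]; rewrite Ap; exact: mF.
- move=> _ _ [i Di <-] [j Dj <-]; rewrite !Ap => /(tF i j Di Dj).
  by move=> ->.
Qed.

Lemma null_countable_bigcup (P : probability T R) (F : I -> set T) :
  (forall i, measurable (F i)) -> (forall i, P (F i) = 0) ->
  P (\bigcup_(i in [set: I]) F i) = 0.
Proof.
move=> mF F0; pose A n := oapp F set0 (@unpickle I n).
have mA n : measurable (A n).
  by rewrite /A; case: unpickle => [i|] /=; [exact: mF|exact: measurable0].
have mU : measurable (\bigcup_(i in [set: I]) F i).
  by apply: measurable_countable_bigcup => i _; exact: mF.
apply/eqP; rewrite eq_le measure_ge0 andbT.
apply: le_trans (measure_sigma_subadditive P mA mU _) _.
  by move=> w [i _ Fi]; exists (pickle i) => //; rewrite /A pickleK.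
rewrite eseries0// => n _ _; rewrite /A.
by case: unpickle => [i|] /=; rewrite ?F0 ?measure0.
Qed.

End CountableSums.

(** * First exit events *)

Section ExitEvents.
Context d (T : measurableType d) (S : countType).
Variable X : nat -> T -> S.
Hypothesis mX : forall k x, measurable (X k @^-1` [set x]).

Lemma measurable_in k (D : set S) : measurable [set w | D (X k w)].
Proof.
have -> : [set w | D (X k w)] = \bigcup_(x in D) (X k @^-1` [set x]).
  by apply/seteqP; split => [w Dw|w [x Dx /= ->]]//; exists (X k w).
exact: measurable_countable_bigcup.
Qed.

Lemma measurable_in_before n (D : nat -> set S) :
  measurable [set w | forall k, (k < n)%N -> D k (X k w)].
Proof.
elim: n => [|n IH].
  by rewrite (_ : [set w | _] = setT)//; apply/seteqP; split.
rewrite (_ : [set w | _] =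
  [set w | forall k, (k < n)%N -> D k (X k w)] `&` [set w | D n (X n w)]).
  exact: measurableI (measurable_in _ _).
apply/seteqP; split => [w H|w [H Hn] k].
  by split => [k kn|]; apply: H => //; exact: ltnW.
by rewrite ltnS leq_eqVlt => /predU1P[->//|]; exact: H.
Qed.

Definition at_before (B : set S) n x : set T :=
  [set w | X n w = x /\ forall k, (k < n)%N -> B (X k w)].

Lemma measurable_at_before B n x : measurable (at_before B n x).
Proof.
rewrite (_ : at_before B n x =
  X n @^-1` [set x] `&` [set w | forall k, (k < n)%N -> B (X k w)]).
  exact: measurableI (measurable_in_before n (fun=> B)).
by apply/seteqP; split.
Qed.

Definition exit_at (B : set S) z : set T :=
  [set w | first_exit B (fun k => X k w) z].

Lemma exit_atE B z :
  exit_at B z = \bigcup_(n in [set _ | ~ B z]) at_before B n z.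
Proof.
apply/seteqP; split => [w [n [nz nB Bk]]|w [n /= nB [nz Bk]]].
  by exists n => //=; rewrite -nz.
by exists n; split=> //; rewrite nz.
Qed.

Lemma trivIset_at_before B z : ~ B z -> trivIset setT (fun n => at_before B n z).
Proof.
move=> nB i j _ _ [w [[iz iB] [jz jB]]]; apply/eqP; rewrite eqn_leq.
apply/andP; split; rewrite leqNgt; apply/negP => h.
  by have := iB _ h; rewrite jz.
by have := jB _ h; rewrite iz.
Qed.

Lemma measurable_exit_at B z : measurable (exit_at B z).
Proof.
rewrite exit_atE; apply: measurable_countable_bigcup => n _.
exact: measurable_at_before.
Qed.

Lemma exit_at_inj B z z' w : exit_at B z w -> exit_at B z' w -> z = z'.
Proof.
move=> [n [nz nB nk]] [n' [nz' nB' nk']].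
have [h|h|e] := ltngtP n n'.
- by have := nk' _ h; rewrite nz.
- by have := nk _ h; rewrite nz'.
- by rewrite -nz -nz' e.
Qed.

Lemma exit_atNB B z w : exit_at B z w -> ~ B z.
Proof. by case=> n []. Qed.

Definition never_exit (B : set S) : set T := [set w | forall k, B (X k w)].

Lemma measurable_never_exit B : measurable (never_exit B).
Proof.
rewrite (_ : never_exit B = \bigcap_k [set w | B (X k w)]).
  by apply: bigcapT_measurable => k; exact: measurable_in.
by apply/seteqP; split => [w H k _|w H k]; exact: H.
Qed.

Lemma never_exitP B w : never_exit B w \/ exists z, exit_at B z w.
Proof.
have [h|/existsNP[n nB]] := pselect (forall k, B (X k w)); first by left.
right; have ex : exists k, `[< ~ B (X k w) >] by exists n; exact/asboolP.
case: (ex_minnP ex) => k /asboolP kB kmin; exists (X k w), k; split => // j jk.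
by apply: contrapT => jB; have := kmin j (introT (asboolP _) jB); rewrite leqNgt jk.
Qed.

End ExitEvents.

(** * Optional stopping for supersolutions *)

Section Supersolutions.
Context (R : realType) d (T : measurableType d) (P : probability T R).
Context (S : countType) (mu : S -> R) (p : S -> S -> R) (X : nat -> T -> S).
Hypothesis p_ge0 : forall x z, 0 <= p x z.
Hypothesis mc : markov_chain P mu p X.

Let mX k x : measurable (X k @^-1` [set x]).
Proof. by case: mc. Qed.

(** [markov_chain] speaks of completely prescribed paths only. Summing over the position at one more
    time, by induction on [j], relaxes the prescription to staying in [B]. *)
Lemma markov_past (B : set S) n j (x : nat -> S) : (j <= n)%N ->
  P [set w | (forall k, (k < j)%N -> B (X k w)) /\
             forall k, (j <= k <= n.+1)%N -> X k w = x k] =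
  (P [set w | (forall k, (k < j)%N -> B (X k w)) /\
              forall k, (j <= k <= n)%N -> X k w = x k] * (p (x n) (x n.+1))%:E)%E.
Proof.
have mE m i y : measurable [set w | (forall k, (k < i)%N -> B (X k w)) /\
             forall k, (i <= k <= m)%N -> X k w = y k].
  rewrite (_ : [set w | _] = [set w | forall k, (k < i)%N -> B (X k w)] `&`
    [set w | forall k, (k < m.+1)%N -> [set z | (i <= k)%N -> z = y k] (X k w)]).
    apply: measurableI; first exact: (measurable_in_before mX i (fun=> B)).
    exact: (measurable_in_before mX _ (fun k => [set z | (i <= k)%N -> z = y k])).
  apply/seteqP; split => w [H1 H2]; split => // k.
    by move=> km ik; apply: H2; rewrite ik.
  by move=> /andP[ik km]; exact: H2.
elim: j x => [|j IH] x jn.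
  have [_ _ h] := mc.
  have E m : [set w | (forall k, (k < 0)%N -> B (X k w)) /\
             forall k, (0 <= k <= m)%N -> X k w = x k] =
             [set w | forall k, (k <= m)%N -> X k w = x k].
    by apply/seteqP; split => [w []//|w H]; split.
  by rewrite !E h.
(* The prescribed path with the free position [s] inserted at time [j]. *)
pose y s k := if k == j then s else x k.
have dec m : (j < m)%N -> P [set w | (forall k, (k < j.+1)%N -> B (X k w)) /\
             forall k, (j < k <= m)%N -> X k w = x k] =
    (\esum_(s in B) P [set w | (forall k, (k < j)%N -> B (X k w)) /\
             forall k, (j <= k <= m)%N -> X k w = y s k])%E.
  move=> jm; rewrite -measure_countable_bigcup//; last first.
  - move=> s s' _ _ [w [[_ H] [_ H']]].
    have := H j; have := H' j; rewrite /y eqxx leqnn (ltnW jm) => -> //.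
    by move=> <-.
  congr (P _); apply/seteqP; split => [w [H1 H2]|w [s Bs [H1 H2]]].
    exists (X j w); first exact: H1.
    split => [k kj|k /andP[jk km]]; first by apply: H1; exact: ltnW.
    rewrite /y; case: eqVneq => [->//|kj]; apply: H2.
    by rewrite km ltn_neqAle eq_sym kj jk.
  split => [k|k /andP[jk km]].
    rewrite ltnS leq_eqVlt => /predU1P[->|]; last exact: H1.
    by rewrite H2 ?leqnn ?(ltnW jm)// /y eqxx.
  by rewrite H2 ?(ltnW jk)// /y gtn_eqF.
rewrite !dec//; last exact: leqW.
rewrite muleC -esumZl//; apply: eq_esum => s Bs.
rewrite IH; last exact: ltnW.
by rewrite /y (gtn_eqF jn) (gtn_eqF (leqW jn)) muleC.
Qed.

Let a (B : set S) n x := P (at_before X B n x).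

Lemma at_before0 B x : a B 0 x = (mu x)%:E.
Proof.
have [_ h _] := mc; rewrite -h; congr (P _).
by apply/seteqP; split => [w []|w].
Qed.

Lemma at_beforeS B n z :
  a B n.+1 z = (\esum_(x in B) (a B n x * (p x z)%:E))%E.
Proof.
rewrite /a; have -> : at_before X B n.+1 z =
    \bigcup_(x in B) (at_before X B n x `&` X n.+1 @^-1` [set z]).
  apply/seteqP; split => [w [nz nB]|w [x Bx [[nx nB] nz]]].
    exists (X n w); first exact: nB.
    by split => //; split => // k kn; apply: nB; exact: ltnW.
  split => // k; rewrite ltnS leq_eqVlt => /predU1P[->|]; last exact: nB.
  by rewrite nx.
rewrite measure_countable_bigcup; last 2 first.
- by move=> x _; apply: measurableI => //; exact: measurable_at_before.
- by move=> x x' _ _ [w [[[<- _] _] [[<- _] _]]].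
apply: eq_esum => x Bx.
pose y k := if (k <= n)%N then x else z.
have := @markov_past B n n y (leqnn n); rewrite /y leqnn ltnn => h.
have E1 : [set w | (forall k, (k < n)%N -> B (X k w)) /\
       (forall k, (n <= k <= n)%N -> X k w = y k)] = at_before X B n x.
  apply/seteqP; split => [w [H1 H2]|w [H1 H2]]; split => //.
    by rewrite H2 ?leqnn// /y leqnn.
  by move=> k; rewrite -eqn_leq => /eqP <-; rewrite /y leqnn.
have E2 : [set w | (forall k, (k < n)%N -> B (X k w)) /\
       (forall k, (n <= k <= n.+1)%N -> X k w = y k)] =
    at_before X B n x `&` X n.+1 @^-1` [set z].
  apply/seteqP; split => [w [H1 H2]|w [[H1 H2] H3]].
    split; last by rewrite /= H2 ?leqnn ?leqnSn// /y ltnn.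
    by split => //; rewrite H2 ?leqnn ?leqnSn// /y leqnn.
  split => // k /andP[nk]; rewrite leq_eqVlt => /predU1P[->|].
    by rewrite /y ltnn.
  rewrite ltnS => kn; have -> : k = n by apply/eqP; rewrite eqn_leq kn.
  by rewrite /y leqnn.
by rewrite -E2 -E1; exact: h.
Qed.

(** Optional stopping at the minimum of the exit time and [N]: the first sum collects the exits
    before time [N], the second the walks not stopped before [N]. *)
Lemma supersolution_le (B : set S) (g : nat -> S -> R) N :
  (forall n x, 0 <= g n x) ->
  (forall n x, B x ->
    (\esum_(z in setT) (p x z * g n.+1 z)%:E <= (g n x)%:E)%E) ->
  (\sum_(n < N) \esum_(z in ~` B) (a B n z * (g n z)%:E)
   + \esum_(x in setT) (a B N x * (g N x)%:E)
   <= \esum_(x in setT) (mu x * g 0%N x)%:E)%E.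
Proof.
move=> g0 sup; have ag n x : (0 <= a B n x * (g n x)%:E)%E.
  by rewrite mule_ge0// lee_fin.
elim: N => [|N IH].
  rewrite big_ord0 add0e; apply: le_esum => x _.
  by rewrite at_before0 EFinM.
(* The mass outside [B] at time [N] joins the exits; only the mass inside [B] makes a further
   step. *)
apply: le_trans IH; rewrite big_ord_recr/= -addeA leeD2l//.
rewrite [leRHS](esumID B)// !setTI addeC leeD2r//.
have -> : (\esum_(z in setT) (a B N.+1 z * (g N.+1 z)%:E))%E
    = (\esum_(x in B) (\esum_(z in setT) (a B N x * (p x z * g N.+1 z)%:E)))%E.
  rewrite exchange_esum; last by move=> *; rewrite mule_ge0// lee_fin mulr_ge0.
  apply: eq_esum => z _; rewrite (at_beforeS B N z) muleC -esumZl//; last first.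
    by move=> *; rewrite mule_ge0// lee_fin.
  by apply: eq_esum => x Bx; rewrite EFinM muleCA [(_ * (p _ _)%:E)%E]muleC.
apply: le_esum => x Bx.
have afin : a B N x \is a fin_num by rewrite fin_num_measure//; exact: measurable_at_before.
rewrite -(fineK afin) esumZl//; last by move=> z; rewrite lee_fin mulr_ge0.
- by rewrite lee_wpmul2l ?sup// lee_fin fine_ge0.
- by rewrite fine_ge0.
Qed.

(** [supersolution_le] with a time-independent [g]: the term at time [N] is dropped as nonnegative
    and [N] tends to infinity. *)
Lemma exit_superharmonic (B : set S) (g : S -> R) :
  (forall x, 0 <= g x) ->
  (forall x, B x -> (\esum_(z in setT) (p x z * g z)%:E <= (g x)%:E)%E) ->
  (\esum_(z in setT) (P (exit_at X B z) * (g z)%:E)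
   <= \esum_(x in setT) (mu x * g x)%:E)%E.
Proof.
move=> g0 sup.
have -> : (\esum_(z in setT) (P (exit_at X B z) * (g z)%:E) =
   \esum_(z in ~` B) (P (exit_at X B z) * (g z)%:E))%E.
  rewrite [RHS]esum_mkcond; apply: eq_esum => z _; case: ifPn => //.
  rewrite notin_setE /= => /contrapT Bz.
  rewrite (_ : exit_at X B z = set0) ?measure0 ?mul0e//.
  by apply/seteqP; split => // w [n []].
have -> : (\esum_(z in ~` B) (P (exit_at X B z) * (g z)%:E) =
  \esum_(n in [set: nat]) \esum_(z in ~` B) (a B n z * (g z)%:E))%E.
  rewrite exchange_esum; last by move=> *; rewrite mule_ge0// lee_fin.
  apply: eq_esum => z Bz; rewrite exit_atE.
  rewrite measure_countable_bigcup; last 2 first.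
  - by move=> n _; exact: measurable_at_before.
  - by move=> i j _ _; exact: trivIset_at_before.
  have -> : [set _ : nat | ~ B z] = setT by apply/seteqP; split.
  rewrite muleC -esumZl//; apply: eq_esum => n _; exact: muleC.
pose F n := (\esum_(z in ~` B) (a B n z * (g z)%:E))%E.
rewrite -(@nneseries_esumT R F); last first.
  by move=> n; apply: esum_ge0 => z _; rewrite mule_ge0// lee_fin.
apply: lime_le.
  apply: is_cvg_nneseries => n _ _; apply: esum_ge0 => z _.
  by rewrite mule_ge0// lee_fin.
apply: nearW => N; rewrite big_mkord.
apply: le_trans (@supersolution_le B (fun=> g) N _ _) => //.
by rewrite leeDl//; apply: esum_ge0 => z _; rewrite mule_ge0// lee_fin.
Qed.

(** Here the exits are dropped and the surviving mass at time [N] is kept. *)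
Lemma never_exit_le (B : set S) (g : nat -> S -> R) N (c : R) :
  (forall n x, 0 <= g n x) ->
  (forall n x, B x ->
    (\esum_(z in setT) (p x z * g n.+1 z)%:E <= (g n x)%:E)%E) ->
  0 <= c -> (forall x, B x -> c <= g N x) ->
  (c%:E * P (never_exit X B) <= \esum_(x in setT) (mu x * g 0%N x)%:E)%E.
Proof.
move=> g0 sup c0 cg; apply: le_trans (supersolution_le N g0 sup).
apply: (@le_trans _ _ (\esum_(x in B) (a B N x * (g N x)%:E))%E); last first.
  rewrite [X in (_ <= _ + X)%E](esumID B); last first.
    by move=> z _; rewrite mule_ge0// lee_fin.
  rewrite setTI addeCA leeDl// adde_ge0//.
    by apply: sume_ge0 => n _; apply: esum_ge0 => z _; rewrite mule_ge0// lee_fin.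
  by apply: esum_ge0 => z _; rewrite mule_ge0// lee_fin.
apply: (@le_trans _ _ (c%:E * \esum_(x in B) a B N x)%E).
  rewrite lee_wpmul2l ?lee_fin// -measure_countable_bigcup; last 2 first.
  - by move=> x _; exact: measurable_at_before.
  - by move=> x x' _ _ [w [[<- _] [<- _]]].
  apply: le_measure; rewrite ?inE.
  - exact: measurable_never_exit.
  - by apply: measurable_countable_bigcup => x _; exact: measurable_at_before.
  - by move=> w H; exists (X N w).
rewrite -esumZl//; apply: le_esum => x Bx.
by rewrite muleC lee_wpmul2l// lee_fin cg.
Qed.

End Supersolutions.

(** * Walks on the cylinder and histories of the aggregate *)

Section Cylinder.
Context (R : realType) (G : sgraph).
Local Notation S := (G * int)%type.
Implicit Types (g : S -> R) (x z : S).

Definition cyl_avg g x : R :=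
  4^-1 * g (x.1, x.2 + 1) + 4^-1 * g (x.1, x.2 - 1)
  + 2^-1 * lazy_op (fun w => g (w, x.2)) x.1.

Lemma cyl_step_ge0 x z : 0 <= cyl_step R x z.
Proof.
rewrite /cyl_step addr_ge0// mulr_ge0 ?invr_ge0//; case: ifP => // _.
exact: lazy_step_ge0.
Qed.

Lemma esum_cyl_step g x : (forall z, 0 <= g z) ->
  (\esum_(z in [set: S]) (cyl_step R x z * g z)%:E = (cyl_avg g x)%:E)%E.
Proof.
move=> g0; case: x => v k.
pose r : seq S := [:: (v, k + 1), (v, k - 1) & [seq (w, k) | w <- enum G]].
have k1 : (k + 1 == k) = false by lia.
have k2 : (k - 1 == k) = false by lia.
have k3 : (k + 1 == k - 1) = false by lia.
have nk e : (e == k) = false -> (v, e) \notin [seq (w, k) | w <- enum G].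
  move=> ek; apply/mapP => -[w _ [_ /eqP]].
  by rewrite ek.
have ur : uniq r.
  rewrite /r /= inE xpair_eqE k3 andbF /= nk// nk//=.
  by rewrite map_inj_uniq ?enum_uniq// => ? ? [].
rewrite (esum_finite_support ur); last 2 first.
- by move=> z; rewrite lee_fin mulr_ge0// cyl_step_ge0.
- move=> [w l]; rewrite !inE !xpair_eqE /= !negb_or => /and3P[h1 h2 h3].
  congr (_%:E); apply/eqP; rewrite mulf_eq0; apply/orP; left.
  rewrite /cyl_step /=.
  have lk : (l == k) = false.
    by apply: contraNF h3 => /eqP ->; apply/mapP; exists w; rewrite ?mem_enum.
  rewrite lk mulr0 addr0; case: ifP; rewrite ?mulr0// => /andP[/eqP wv].
  by move: h1 h2; rewrite wv eqxx /= => /negbTE -> /negbTE ->.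
rewrite sumEFin /r !big_cons big_map big_enum /=; congr (_%:E).
rewrite /cyl_avg /cyl_step /= !eqxx /= k1 k2 orbT !mulr0 !addr0.
have h : (2 : R)^-1 * 2^-1 = 4^-1 by rewrite -invfM -natrM.
rewrite !h -addrA; congr (_ + (_ + _)).
rewrite /lazy_op mulr_sumr; apply: eq_bigr => w _.
by rewrite [k == k + 1]eq_sym [k == k - 1]eq_sym k1 k2 andbF mulr0 add0r mulrA.
Qed.

Lemma esum_cyl_start g : (forall z, 0 <= g z) ->
  (forall v : G, 0 <= piN R v) ->
  (\esum_(x in [set: S]) (cyl_start R x * g x)%:E
   = (\sum_(v : G) piN R v * g (v, 0))%:E)%E.
Proof.
move=> g0 p0; pose r : seq S := [seq (v, 0) | v <- enum G].
have ur : uniq r by rewrite map_inj_uniq ?enum_uniq// => ? ? [].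
rewrite (esum_finite_support ur); last 2 first.
- move=> z; rewrite lee_fin mulr_ge0// /cyl_start; case: ifP => // _.
- move=> [w l] h; rewrite /cyl_start /=; case: eqVneq => [l0|_].
    by case/negP: h; rewrite l0; apply/mapP; exists w; rewrite ?mem_enum.
  by rewrite mul0r.
by rewrite sumEFin /r big_map big_enum.
Qed.

Context d (T : measurableType d) (P : probability T R) (X : nat -> T -> S).
Hypothesis mc : markov_chain P (@cyl_start R G) (@cyl_step R G) X.
Hypothesis deg_gt0 : forall v : G, (0 < deg v)%N.

Lemma piN_ge0 (v : G) : 0 <= piN R v.
Proof. by rewrite /piN divr_ge0. Qed.

(* The starting law has total mass 1 since it is the law of [X 0]. *)
Lemma sum_piN : \sum_(v : G) piN R v = 1.
Proof.
have [mX h _] := mc; apply: EFin_inj.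
have := @esum_cyl_start (fun=> 1) (fun=> ler01) piN_ge0.
under [in X in _ -> X]eq_bigr do rewrite -[piN _ _]mulr1.
move=> <-; rewrite -(probability_setT P).
have -> : [set: T] = \bigcup_(x in [set: S]) (X 0%N @^-1` [set x]).
  by apply/seteqP; split => // w _; exists (X 0%N w).
rewrite measure_countable_bigcup//.
- by apply: eq_esum => x _; rewrite mulr1 h.
- by move=> x x' _ _ [w [/= <- <-]].
Qed.

Lemma cyl_exit_superharmonic (B : set S) (g : S -> R) : (forall x, 0 <= g x) ->
  (forall x, B x -> cyl_avg g x <= g x) ->
  (\esum_(z in setT) (P (exit_at X B z) * (g z)%:E)
   <= (\sum_(v : G) piN R v * g (v, 0))%:E)%E.
Proof.
move=> g0 sup; rewrite -esum_cyl_start//; last exact: piN_ge0.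
apply: (exit_superharmonic cyl_step_ge0 mc g0) => x Bx.
by rewrite esum_cyl_step// lee_fin sup.
Qed.

(* [rho ^- n * r ^+ (distance to level y + 1)] is preserved in mean until the
   walk reaches level [y + 1]. *)
Lemma cyl_never_exit_le (B : set S) (y : nat) (e : R) : 0 < e -> e < 1 ->
  (forall x, B x -> x.2 <= y%:Z) ->
  (P (never_exit X B) <= (2 * (y.+1%:R * e))%:E)%E.
Proof.
move=> e0 e1 By; pose r := 1 - e; have r0 : 0 < r by rewrite subr_gt0.
have r1 : r < 1 by rewrite /r; lra.
pose rho := 2^-1 + 4^-1 * (r + r^-1).
have rho1 : 1 < rho.
  rewrite /rho; suff : 2 < r + r^-1 by lra.
  have : 0 < (1 - r) ^+ 2 * r^-1 by rewrite mulr_gt0 ?invr_gt0// exprn_gt0// subr_gt0.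
  have -> : (1 - r) ^+ 2 * r^-1 = r + r^-1 - 2 by field; rewrite gt_eqF.
  by rewrite subr_gt0.
(* The cut makes [dist] vanish from level [y + 1] on, so that [u] is at most 1 everywhere and [g]
   stays nonnegative. *)
pose dist (k : int) := if k <= y%:Z then `|y.+1%:Z - k|%N else 0%N.
pose u (x : S) := r ^+ dist x.2.
pose g n x := 1 - rho^-1 ^+ n * u x.
have u0 x : 0 <= u x by rewrite exprn_ge0// ltW.
have u1 x : u x <= 1 by rewrite exprn_ile1// ltW.
have q0 n : 0 <= rho^-1 ^+ n by rewrite exprn_ge0// invr_ge0; lra.
have q1 n : rho^-1 ^+ n <= 1.
  by rewrite exprn_ile1// ?invr_ge0 ?invf_le1; lra.
have g0 n x : 0 <= g n x.
  by rewrite subr_ge0 -[leRHS]mulr1 ler_pM.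
(* At this time [g] is at least 1/2 everywhere, whence the factor 2 in the bound. *)
have [N HN] : exists N, rho^-1 ^+ N <= 2^-1.
  have : `|rho^-1| < 1 by rewrite ger0_norm ?invr_ge0 ?invf_lt1; lra.
  move/cvg_expr => /cvgrPdist_le /(_ 2^-1) [] // n _ /(_ n (leqnn n)).
  by rewrite /= sub0r normrN ger0_norm// => h; exists n.
have H := @never_exit_le R d T P _ _ _ X cyl_step_ge0 mc B g N 2^-1 g0.
have {H} : (2^-1%:E * P (never_exit X B) <=
    \esum_(x in [set: S]) (cyl_start R x * g 0%N x)%:E)%E.
  apply: H.
  - move=> n [v k] /By /= ky; rewrite esum_cyl_step// lee_fin le_eqVlt; apply/orP; left.
    apply/eqP; rewrite /cyl_avg /g /=.
    have -> : lazy_op (fun w => 1 - rho^-1 ^+ n.+1 * u (w, k)) v =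
              1 - rho^-1 ^+ n.+1 * u (v, k).
      by rewrite /u /=; exact: lazy_op_cst.
    have [j kj] : exists j : nat, k = y%:Z - j%:Z.
      by exists `|y%:Z - k|%N; rewrite gez0_abs ?subr_ge0// subKr.
    have dk : dist k = j.+1.
      rewrite /dist ky kj; have -> : y.+1%:Z - (y%:Z - j%:Z) = j.+1%:Z by lia.
      by [].
    have dk1 : dist (k - 1) = j.+2.
      rewrite /dist kj; have -> : (y%:Z - j%:Z - 1 <= y%:Z) by lia.
      by have -> : y.+1%:Z - (y%:Z - j%:Z - 1) = j.+2%:Z by lia.
    have dk2 : dist (k + 1) = j.
      rewrite /dist kj; case: ifPn => h.
        by have -> : y.+1%:Z - (y%:Z - j%:Z + 1) = j%:Z by lia.
      lia.
    rewrite /u /= dk dk1 dk2 !exprS; move: (rho^-1 ^+ n) (r ^+ j) => a b.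
    have rhor : rho^-1 * (2^-1 * r + 4^-1 * (r ^+ 2 + 1)) = r.
      rewrite /rho; field; rewrite gt_eqF//=.
      have r2 : 0 < r * r by exact: mulr_gt0.
      by apply/eqP => h; lra.
    transitivity (1 - (rho^-1 * (2^-1 * r + 4^-1 * (r ^+ 2 + 1))) * a * b).
      by move: (rho^-1) => q; field.
    by rewrite rhor; ring.
  - by rewrite invr_ge0.
  - move=> x _; rewrite /g; have : rho^-1 ^+ N * u x <= 2^-1 * 1.
      by rewrite ler_pM.
    lra.
rewrite esum_cyl_start//; last exact: piN_ge0.
have -> : \sum_(v : G) piN R v * g 0%N (v, 0) = 1 - r ^+ y.+1.
  have -> : 1 - r ^+ y.+1 = \sum_(v : G) piN R v * (1 - r ^+ y.+1).
    by rewrite -mulr_suml sum_piN mul1r.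
  apply: eq_bigr => v _; rewrite /g expr0 mul1r /u /dist /=.
  by rewrite addn0.
move=> H; have b := bernoulli_ineq y.+1 (ltW e0) (ltW e1).
rewrite EFinM -lee_pdivrMl// (le_trans H)// lee_fin /r; lra.
Qed.

Lemma cyl_never_exit (B : set S) (y : nat) : (forall x, B x -> x.2 <= y%:Z) ->
  P (never_exit X B) = 0%E.
Proof.
move=> By; have mX : forall k x, measurable (X k @^-1` [set x]) by case: mc.
have fin : P (never_exit X B) \is a fin_num.
  by rewrite fin_num_measure//; exact: measurable_never_exit.
have := @cyl_never_exit_le B y; rewrite -(fineK fin).
have : 0 <= fine (P (never_exit X B)) by rewrite fine_ge0.
move: (fine _) => q q0 H; congr (_%:E); apply/eqP; rewrite eq_le q0 andbT.
rewrite leNgt; apply/negP => qp.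
(* With this [e] the bound of [cyl_never_exit_le] is at most [q / 2], which contradicts [q > 0]. *)
pose e : R := Num.min 2^-1 (q / (4 * y.+1%:R)).
have e0 : 0 < e by rewrite lt_min invr_gt0 ltr0n /= divr_gt0// mulr_gt0.
have e1 : e < 1 by rewrite gt_min; apply/orP; left; lra.
have := H e e0 e1 By; rewrite lee_fin => h.
have : e <= q / (4 * y.+1%:R) by rewrite ge_min lexx orbT.
have yp : 0 < (4 * y.+1%:R : R) by rewrite mulr_gt0.
by rewrite ler_pdivlMr//; lra.
Qed.

End Cylinder.

(** * Histories of settled sites and their probabilities *)

Section Histories.
Context (R : realType) (G : sgraph) d (Omega : measurableType d).
Context (P : probability Omega R).
Local Notation S := (G * int)%type.
Variable X : nat -> nat -> Omega -> S.
Hypothesis mc : forall t, markov_chain P (@cyl_start R G) (@cyl_step R G) (X t).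
Hypothesis indep : mutually_independent P (fun t => generated_sigma (X t)).
Hypothesis deg_gt0 : forall v : G, (0 < deg v)%N.
Implicit Types (s : seq S) (x z : S) (w : Omega).

Let mX t k x : measurable (X t k @^-1` [set x]).
Proof. by case: (mc t). Qed.

Definition conf s : set S := half_cylinder (0 : R) `|` [set` s].

(* The settled sites are listed with the most recent one first. *)
Fixpoint hist s : set Omega :=
  if s is z :: s' then hist s' `&` exit_at (X (size s')) (conf s') z else setT.

Lemma measurable_hist s : measurable (hist s).
Proof.
elim: s => [|z s IH] //=; apply: measurableI => //.
exact: measurable_exit_at.
Qed.

(** Measurability of exit events is applied on the space that carries only the sigma-algebra
    generated by this walk. *)
Lemma generated_sigma_exit_at t (B : set S) z :
  generated_sigma (X t) (exit_at (X t) B z).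
Proof.
pose T' := g_sigma_algebraType [set B | exists k x, B = X t k @^-1` [set x]].
apply: (@measurable_exit_at _ T' _ (X t : nat -> T' -> S)) => k x.
by apply: sub_sigma_algebra; exists k, x.
Qed.

(** Along a prescribed history each walk faces a deterministic set, so the history is an
    intersection of one event per walk and independence applies. *)
Lemma hist_product s : exists C : nat -> set Omega,
  (forall j, generated_sigma (X j) (C j)) /\ hist s = \bigcap_(j in `I_(size s)) C j.
Proof.
elim: s => [|z s [C [mC hC]]] /=.
  exists (fun=> setT); split; last by apply/seteqP; split.
  by move=> j; exact: (@measurableT _ (g_sigma_algebraType _)).
exists (fun j => if j == size s then exit_at (X (size s)) (conf s) z else C j).
split.
  by move=> j; case: eqP => [->|_]; [exact: generated_sigma_exit_at|exact: mC].
rewrite hC; apply/seteqP; split => [w [H1 H2] j /=|w H].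
  by rewrite ltnS leq_eqVlt; case: eqP => [//|_] /= js; exact: H1.
split => [j /= js|]; last by have := H (size s); rewrite /= eqxx; apply.
by have := H j; rewrite /= ltn_eqF// ltnS (ltnW js); apply.
Qed.

Lemma probability_hist_cons z s :
  P (hist (z :: s)) = (P (hist s) * P (exit_at (X (size s)) (conf s) z))%E.
Proof.
have [C [mC hC]] := hist_product s.
pose C' j := if j == size s then exit_at (X (size s)) (conf s) z else C j.
have mC' j : generated_sigma (X j) (C' j).
  by rewrite /C'; case: eqP => [->|_]; [exact: generated_sigma_exit_at|exact: mC].
have e n : [set` iota 0 n] = `I_n.
  by apply/seteqP; split => j /=; rewrite mem_iota add0n.
have h1 := @indep (iota 0 (size s)) C (iota_uniq _ _) (fun j _ => mC j).
have h2 := @indep (iota 0 (size s).+1) C' (iota_uniq _ _) (fun j _ => mC' j).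
rewrite e -hC in h1; rewrite e in h2.
have -> : hist (z :: s) = \bigcap_(j in `I_(size s).+1) C' j.
  rewrite /= hC; apply/seteqP; split => [w [H1 H2] j /=|w H].
    rewrite ltnS leq_eqVlt /C'; case: eqP => [//|_] /= js; exact: H1.
  split => [j /= js|]; last by have := H (size s); rewrite /= /C' eqxx; apply.
  by have := H j; rewrite /= /C' ltn_eqF// ltnS (ltnW js); apply.
rewrite h2 -addn1 iotaD big_cat big_seq1 add0n /= {2}/C' eqxx h1; congr (_ * _)%E.
rewrite big_seq [RHS]big_seq; apply: eq_bigr => j; rewrite mem_iota add0n /= => js.
by rewrite /C' ltn_eqF.
Qed.

Lemma hist_aggregate (A : nat -> Omega -> set S) s w :
  A 0%N w = half_cylinder (0 : R) ->
  (forall t, A t.+1 w = A t w `|` first_exit (A t w) (fun k => X t k w)) ->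
  hist s w -> A (size s) w = conf s.
Proof.
move=> A0 AS; elim: s => [_|z s IH] /=.
  by rewrite A0 /conf; apply/seteqP; split => x; [left|case].
move=> [/IH hs hz]; rewrite AS hs; apply/seteqP; split => x.
  move=> [[H|/= xs]|xe]; [by left|by right; rewrite /= inE xs orbT|].
  by right; rewrite /= inE (exit_at_inj xe hz) eqxx.
move=> [H|/=]; first by left; left.
by rewrite inE => /orP[/eqP ->|xs]; [right|left; right].
Qed.

Lemma hist_inj s s' w : size s = size s' -> hist s w -> hist s' w -> s = s'.
Proof.
elim: s s' => [|z s IH] [|z' s']//= [ss'] [hs hz] [hs' hz'].
have e := IH _ ss' hs hs'; rewrite -e in hz' *.
by rewrite (exit_at_inj hz hz').
Qed.

Lemma hist_uniq s w : hist s w -> uniq s /\ (forall z, z \in s -> 0 < z.2).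
Proof.
elim: s => [|z s IH] //= [/IH[us pos] /exit_atNB nz]; split.
  by rewrite us andbT; apply/negP => zs; apply: nz; right.
move=> x; rewrite inE => /orP[/eqP->|]; last exact: pos.
by rewrite ltNge; apply/negP => h; apply: nz; left; rewrite /half_cylinder /= lerz0.
Qed.

Lemma hist_drop s n w : hist s w -> hist (drop n s) w.
Proof. by elim: s n => [|z s IH] [|n] //= [/IH]. Qed.

(** The union runs over the countably many deterministic configurations instead of the random
    aggregate, so each term is a null event of a single walk. Off this event every particle
    settles. *)
Definition lost : set Omega :=
  \bigcup_(s in [set: seq S]) never_exit (X (size s)) (conf s).

Lemma measurable_lost : measurable lost.
Proof.
by apply: measurable_countable_bigcup => s _; exact: measurable_never_exit.
Qed.

Lemma probability_lost : P lost = 0%E.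
Proof.
apply: null_countable_bigcup => s; first exact: measurable_never_exit.
have [y Hy] : exists y : nat, forall x, conf s x -> x.2 <= y%:Z.
  elim: s => [|z s [y Hy]].
    by exists 0%N => x [|//]; rewrite /half_cylinder /= lerz0.
  exists (maxn y `|z.2|%N) => x [H|/=].
    have := Hy x (or_introl H); lia.
  rewrite inE => /orP[/eqP->|xs]; first lia.
  have := Hy x (or_intror xs); lia.
exact: (cyl_never_exit (mc (size s)) deg_gt0 Hy).
Qed.

Lemma histP t w : ~ lost w -> exists2 s, size s = t & hist s w.
Proof.
move=> nl; elim: t => [|t [s st hs]]; first by exists [::].
have [nv|[z hz]] := never_exitP (X (size s)) (conf s) w.
  by case: nl; exists s.
by exists (z :: s); [rewrite /= st|split].
Qed.

Lemma esum_seqS t (f : seq S -> \bar R) : (forall s, 0 <= f s)%E ->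
  (\esum_(s in [set s | size s = t.+1]) f s =
   \esum_(s in [set s | size s = t]) \esum_(z in [set: S]) f (z :: s))%E.
Proof.
move=> f0; rewrite esum_esum//.
apply: (@reindex_esum _ _ _ _ _ (fun k : seq S * S => k.2 :: k.1)); split.
- by move=> [s z] [/= -> _].
- by move=> [s z] [s' z'] _ _ /= [-> ->].
- by move=> [|z s]//= [st]; exists (s, z).
Qed.

(** The supermartingale of products of [psi], written as a sum over histories. One-step control is
    needed only while [z0] is vacant, because [psi z0 = 0] kills the product afterwards. *)
Lemma esum_hist_prod_le t (psi : S -> R) z0 : (forall z, 0 <= psi z) -> psi z0 = 0 ->
  (forall s, z0 \notin s ->
    (\esum_(z in [set: S]) (P (exit_at (X (size s)) (conf s) z) * (psi z)%:E) <= 1)%E) ->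
  (\esum_(s in [set s | size s = t]) (P (hist s) * (\prod_(z <- s) psi z)%:E) <= 1)%E.
Proof.
move=> psi0 psiz H.
have pr0 s : 0 <= \prod_(z <- s) psi z by exact: prodr_ge0.
elim: t => [|t IH].
  have -> : [set s : seq S | size s = 0%N] = [set [::]].
    by apply/seteqP; split => s /=; [move/size0nil|move=> ->].
  rewrite esum_set1; last by rewrite mule_ge0// lee_fin.
  by rewrite big_nil mule1 probability_setT.
rewrite esum_seqS; last by move=> s; rewrite mule_ge0// lee_fin.
apply: le_trans IH; apply: le_esum => s st.
have [zs|zs] := boolP (z0 \in s).
  rewrite esum1; first by rewrite mule_ge0// lee_fin.
  move=> z _; rewrite (_ : \prod_(_ <- _) _ = 0) ?mule0//.
  apply/eqP; rewrite prodf_seq_eq0; apply/hasP; exists z0; rewrite ?psiz ?eqxx//.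
  by rewrite inE zs orbT.
have fin : P (hist s) \is a fin_num by rewrite fin_num_measure//; exact: measurable_hist.
have -> : (\esum_(z in [set: S]) (P (hist (z :: s)) * (\prod_(z1 <- z :: s) psi z1)%:E) =
   \esum_(z in [set: S]) ((fine (P (hist s)) * \prod_(z1 <- s) psi z1)%:E *
      (P (exit_at (X (size s)) (conf s) z) * (psi z)%:E)))%E.
  apply: eq_esum => z _; rewrite probability_hist_cons big_cons !EFinM fineK//.
  by rewrite -!muleA; congr (_ * _)%E; rewrite muleC -muleA muleC -!muleA; congr (_ * _)%E; rewrite muleC.
rewrite esumZl; last 2 first.
- by rewrite mulr_ge0// fine_ge0.
- by move=> z; rewrite mule_ge0// lee_fin.
rewrite -[leRHS]mule1 EFinM fineK//; apply: lee_wpmul2l; last exact: H.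
by rewrite mule_ge0// lee_fin.
Qed.

Lemma trivIset_hist t (D : set (seq S)) : (forall s, D s -> size s = t) ->
  trivIset D hist.
Proof.
by move=> Dt s s' Ds Ds' [w [hs hs']]; apply: (hist_inj _ hs hs'); rewrite !Dt.
Qed.

Definition missed t z0 : set Omega :=
  \bigcup_(s in [set s | size s = t /\ z0 \notin s]) hist s.

Lemma measurable_missed t z0 : measurable (missed t z0).
Proof. by apply: measurable_countable_bigcup => s _; exact: measurable_hist. Qed.

(** Markov's inequality for the product of [psi], which is at least [c] on every possible history
    that misses [z0]. *)
Lemma probability_missed t (psi : S -> R) z0 (c : R) :
  (forall z, 0 <= psi z) -> psi z0 = 0 -> 0 < c ->
  (forall s, z0 \notin s ->
    (\esum_(z in [set: S]) (P (exit_at (X (size s)) (conf s) z) * (psi z)%:E) <= 1)%E) ->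
  (forall s w, size s = t -> z0 \notin s -> hist s w -> c <= \prod_(z <- s) psi z) ->
  (P (missed t z0) <= c^-1%:E)%E.
Proof.
move=> psi0 psiz c0 H Hc.
rewrite /missed measure_countable_bigcup; last 2 first.
- by move=> s _; exact: measurable_hist.
- by apply: (@trivIset_hist t) => s [].
rewrite -[leRHS]mule1 lee_pdivlMl// -esumZl ?(ltW c0)//.
apply: le_trans (esum_hist_prod_le t psi0 psiz H).
rewrite [leRHS](esumID [set s : seq S | z0 \notin s]); last first.
  by move=> s _; rewrite mule_ge0// lee_fin prodr_ge0.
rewrite -[leLHS]adde0; apply: leeD; last first.
  by apply: esum_ge0 => s _; rewrite mule_ge0// lee_fin prodr_ge0.
apply: le_esum => s [st zs]; have [->|/set0P[w hw]] := eqVneq (hist s) set0.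
  by rewrite measure0 mule0 mul0e.
by rewrite muleC lee_wpmul2l// lee_fin (Hc _ w).
Qed.

Definition jumped t (Q : set (seq S)) (H : set S) : set Omega :=
  \bigcup_(k in [set s | size s = t /\ Q s] `*`` (fun=> H)) hist (k.2 :: k.1).

Lemma measurable_jumped t Q H : measurable (jumped t Q H).
Proof.
by apply: measurable_countable_bigcup => -[s z] _; exact: measurable_hist.
Qed.

(** Histories of equal length are disjoint, so a bound valid after each possible one survives
    averaging over them. *)
Lemma probability_jumped t Q H (e : R) : 0 <= e ->
  (forall s w, size s = t -> Q s -> hist s w ->
    (\esum_(z in H) P (exit_at (X (size s)) (conf s) z) <= e%:E)%E) ->
  (P (jumped t Q H) <= e%:E)%E.
Proof.
move=> e0 He; rewrite /jumped measure_countable_bigcup; last 2 first.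
- by move=> [s z] _; exact: measurable_hist.
- move=> [s z] [s' z'] [[st _] _] [[st' _] _] [w [h h']].
  by have [-> ->] : z :: s = z' :: s' by apply: (hist_inj _ h h'); rewrite /= st st'.
rewrite -(@esum_esum _ _ _ _ (fun=> H) (fun s z => P (hist (z :: s))))//.
apply: (@le_trans _ _ (e%:E * \esum_(s in [set s | size s = t /\ Q s]) P (hist s))%E).
  rewrite -esumZl//; apply: le_esum => s [st Qs].
  have [h0|/set0P[w hw]] := eqVneq (hist s) set0.
    rewrite h0 measure0 mule0 esum1// => z _.
    by rewrite /= h0 set0I measure0.
  have fin : P (hist s) \is a fin_num by rewrite fin_num_measure//; exact: measurable_hist.
  under eq_esum => z _ do rewrite probability_hist_cons -(fineK fin).
  rewrite esumZl ?fine_ge0// muleC fineK//; apply: lee_wpmul2r => //.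
  exact: He hw.
rewrite -measure_countable_bigcup; last 2 first.
- by move=> s _; exact: measurable_hist.
- by apply: (@trivIset_hist t) => s [].
rewrite -[leRHS]mule1 lee_wpmul2l ?lee_fin// probability_le1//.
by apply: measurable_countable_bigcup => s _; exact: measurable_hist.
Qed.

End Histories.

(** * Inner bound *)

Section InnerBarrier.
Context (R : realType) (G : sgraph) (tau : nat) (delta delta' : R).
Local Notation S := (G * int)%type.
Local Notation N := #|G|.
Hypothesis deg_gt0 : forall v : G, (0 < deg v)%N.
Hypothesis tau_gt0 : (0 < tau)%N.
Hypothesis tau_mix : forall v w : G,
  tv_dist (lazy_law R tau v) (lazy_law R tau w) <= 2^-1.
Hypothesis sum_pi1 : \sum_(v : G) piN R v = 1.
Hypothesis delta_gt0 : 0 < delta.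
Hypothesis piN_bounds : forall v : G, delta / N%:R <= piN R v <= delta' / N%:R.
Implicit Types (g : S -> R) (x z : S).

Lemma cyl_avg_le g g' x : (forall z, g z <= g' z) -> cyl_avg g x <= cyl_avg g' x.
Proof.
move=> gg'; rewrite /cyl_avg.
have h : lazy_op (fun w => g (w, x.2)) x.1 <= lazy_op (fun w => g' (w, x.2)) x.1.
  by apply: lazy_op_le => w; exact: gg'.
by rewrite lerD ?lerD// ler_wpM2l ?invr_ge0.
Qed.

Lemma cyl_avg_affine a b g x :
  cyl_avg (fun z => a + b * g z) x = a + b * cyl_avg g x.
Proof.
rewrite /cyl_avg lazy_opD lazy_opZ lazy_op_cst//.
by field.
Qed.

Lemma cyl_avg_cst (a : R) x : cyl_avg (fun _ : S => a) x = a.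
Proof. by rewrite /cyl_avg lazy_op_cst//; field. Qed.

Lemma piN_le1 (v : G) : piN R v <= 1.
Proof.
by rewrite -sum_pi1 (bigD1 v)//= lerDl sumr_ge0// => w _; exact: piN_ge0.
Qed.

Lemma card_vertex_gt0 (v : G) : 0 < N%:R :> R.
Proof. by rewrite ltr0n; apply/card_gt0P; exists v. Qed.

(** Bounds the sum over one level of the deviations of [h] from [piN v]: the constants [piN v] add
    up to at most [delta'], and the values of [h] to at most [delta' / delta], since their
    [piN]-mean is [piN v]. *)
Definition osc_cost : R := delta' / delta + delta'.

(* The supersolution behind the inner bound: up to the affine normalisation,
   the probability that the walk hits the level of the target first at the
   target. *)
Lemma inner_supersolution (v : G) (y L : nat) : (0 < y)%N ->
  N%:R * level_rate R tau ^+ L <= 1 ->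
  exists psi : S -> R, exists dev : nat -> G -> R,
  [/\ forall x, 0 <= psi x,
      psi (v, y%:Z) = 0,
      forall x, x != (v, y%:Z) -> cyl_avg psi x <= psi x,
      \sum_(u : G) piN R u * psi (u, 0) <= 1 &
   [/\ forall x, x != (v, y%:Z) -> y%:Z <= x.2 -> psi x = 1 + piN R v / 2,
      forall j u, (0 < j)%N -> 1 - dev j u / 2 <= psi (u, y%:Z - j%:Z),
      forall j u, 0 <= dev j u <= 1 &
      forall m, \sum_(j < m) \sum_(u : G) dev j u <=
         osc_cost * L%:R + 4 * Num.sqrt tau%:R]].
Proof.
move=> y0 HL; have Np := card_vertex_gt0 v.
pose f (u : G) : R := (u == v)%:R.
have f01 u : 0 <= f u <= 1 by rewrite /f; case: eqP; rewrite ?ler01 ?lexx.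
have [h [h0 h01 hrec hmean hosc]] := harmonic_extension deg_gt0 tau_gt0 tau_mix f01.
have piv j : \sum_(u : G) piN R u * h j u = piN R v.
  rewrite hmean (bigD1 v)//= /f eqxx mulr1 big1 ?addr0// => u /negbTE ->.
  by rewrite mulr0.
pose hh x := if x.2 <= y%:Z then h `|(y%:Z - x.2)%R|%N x.1 else 0.
pose p := piN R v.
have p0 : 0 <= p by exact: piN_ge0.
have p1 : p <= 1 by exact: piN_le1.
(* The additive constant makes the mean over the starting law equal to 1, because [h] has [piN]-mean
   [p] on level 0. *)
pose psi' x := 1 + 2^-1 * p + - 2^-1 * hh x.
(* Lowering the value at the target alone preserves the inequality at all other sites. *)
pose psi x := if x == (v, y%:Z) then 0 else psi' x.
pose dev j u := `|p - h j u|.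
have hh01 x : 0 <= hh x <= 1 by rewrite /hh; case: ifP; rewrite ?h01 ?lexx ?ler01.
have psi'0 x : 0 <= psi' x.
  by have := hh01 x; rewrite /psi'; lra.
have psi_le x : psi x <= psi' x by rewrite /psi; case: ifP.
have psi_top x : psi x <= 1 + p / 2.
  by apply: le_trans (psi_le x) _; have := hh01 x; rewrite /psi'; lra.
have hhy (x : S) : x != (v, y%:Z) -> y%:Z <= x.2 -> hh x = 0.
  case: x => u k /= nx yk; rewrite /hh /=; case: ifPn => // ky.
  have ek : k = y%:Z by apply/eqP; rewrite eq_le ky yk.
  rewrite ek subrr h0 /f; case: eqVneq => // uv.
  by case/eqP: nx; rewrite uv ek.
have high x : x != (v, y%:Z) -> y%:Z <= x.2 -> psi x = 1 + p / 2.
  move=> nx yk; rewrite /psi (negbTE nx) /psi' hhy//; lra.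
have dev01 j u : 0 <= dev j u <= 1.
  rewrite normr_ge0 /= ler_norml; have := h01 j u; lra.
exists psi, dev; split => //.
- by move=> x; rewrite /psi; case: ifP.
- by rewrite /psi eqxx.
(* From level [y] on, [psi] takes its maximal value away from the target; below, [psi'] is
   harmonic. *)
- move=> x nx; have [yk|ky] := leP (y%:Z) x.2.
    rewrite high//; apply: le_trans (cyl_avg_le _ psi_top) _.
    by rewrite cyl_avg_cst.
  rewrite /psi (negbTE nx); apply: le_trans (cyl_avg_le _ psi_le) _.
  rewrite /psi' cyl_avg_affine le_eqVlt; apply/orP; left; apply/eqP.
  congr (_ + _ * _); case: x nx ky => u k /= nx ky.
  have [i ki] : exists i : nat, k = y%:Z - i.+1%:Z.
    by exists `|(y%:Z - k - 1)%R|%N; lia.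
  have e1 : `|(y%:Z - k)%R|%N = i.+1 by lia.
  have e2 : `|(y%:Z - (k + 1))%R|%N = i by lia.
  have e3 : `|(y%:Z - (k - 1))%R|%N = i.+2 by lia.
  have l1 : k <= y%:Z by lia.
  have l2 : k + 1 <= y%:Z by lia.
  have l3 : k - 1 <= y%:Z by lia.
  by rewrite /cyl_avg /hh /= l1 l2 l3 e1 e2 e3 [RHS]hrec [X in X + _ = _]addrC.
- apply: (@le_trans _ _ (\sum_(u : G) piN R u * psi' (u, 0))).
    by apply: ler_sum => u _; rewrite ler_wpM2l// piN_ge0.
  have -> : \sum_(u : G) piN R u * psi' (u, 0) =
     \sum_(u : G) ((1 + 2^-1 * p) * piN R u + - 2^-1 * (piN R u * h y u)).
    apply: eq_bigr => u _; rewrite /psi' /hh /= addn0; ring.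
  rewrite big_split/= -!mulr_sumr sum_pi1 piv -/p; lra.
split => //.
- move=> j u j0; have nx : (u, y%:Z - j%:Z) != (v, y%:Z).
    by rewrite xpair_eqE negb_and; apply/orP; right; lia.
  rewrite /psi (negbTE nx) /psi' /hh /= ifT; last by lia.
  rewrite (_ : `|(y%:Z - (y%:Z - j%:Z))%R|%N = j); last by lia.
  have : - dev j u <= p - h j u by rewrite /dev lerNl -normrN ler_norm.
  lra.
- move=> m; have [r12 r1] := andP (level_rate_bounds R tau_gt0).
  have r0 : 0 <= level_rate R tau by lra.
  have inv : (1 - level_rate R tau)^-1 = 2 * Num.sqrt tau%:R.
    by rewrite /level_rate subKr invrK.
  apply: le_trans (@sum_le_cut R (fun j => \sum_(u : G) dev j u)
    osc_cost 2 (level_rate R tau) L m r0 r1 _ _ _) _ => //.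
  + move=> j; apply: (@le_trans _ _ (\sum_(u : G) (p + h j u))).
      apply: ler_sum => u _; rewrite ler_norml.
      by have := h01 j u; lra.
    rewrite big_split/= sumr_const addrC /osc_cost; apply: lerD; last first.
      have /andP[_] := piN_bounds v; rewrite ler_pdivlMr// mulr_natr.
      by move/(le_trans _); apply; rewrite (@eq_card _ xpredT G).
    have : \sum_(u : G) delta / N%:R * h j u <= \sum_(u : G) piN R u * h j u.
      apply: ler_sum => u _; have /andP[? _] := piN_bounds u.
      by rewrite ler_wpM2r//; case/andP: (h01 j u).
    rewrite -mulr_sumr piv => H; rewrite ler_pdivlMr//.
    have /andP[_] := piN_bounds v; rewrite ler_pdivlMr// => H2.
    apply: le_trans H2; apply: le_trans (ler_wpM2r (ltW Np) H).
    by rewrite mulrAC mulfVK ?gt_eqF// mulrC.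
  (* From distance [L] on, a deviation from the mean is at most the oscillation, and [HL] absorbs
     the factor [N] from summing over vertices. *)
  + move=> j; have hd u : dev (L + j)%N u <= 2 * level_rate R tau ^+ (L + j).
      have E : p - h (L + j)%N u =
          \sum_(w : G) piN R w * (h (L + j)%N w - h (L + j)%N u).
        under eq_bigr do rewrite mulrBr.
        by rewrite sumrB piv -mulr_suml sum_pi1 mul1r.
      have c w : `|h (L + j)%N w - h (L + j)%N u| <= 2 * level_rate R tau ^+ (L + j).
        by rewrite ler_norml lerNl opprB !hosc.
      rewrite /dev E; apply: le_trans (ler_norm_sum _ _ _) _.
      apply: (@le_trans _ _ (\sum_(w : G) piN R w * (2 * level_rate R tau ^+ (L + j)))).
        by apply: ler_sum => w _; rewrite normrM ger0_norm ?piN_ge0// ler_wpM2l ?piN_ge0.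
      by rewrite -mulr_suml sum_pi1 mul1r.
    apply: (@le_trans _ _ (\sum_(u : G) 2 * level_rate R tau ^+ (L + j))).
      by apply: ler_sum => u _.
    rewrite sumr_const (@eq_card _ xpredT G)// -mulr_natr exprD.
    have : 0 <= 2 * level_rate R tau ^+ j by rewrite mulr_ge0// exprn_ge0.
    move=> q; have := ler_wpM2l q HL; lra.
  rewrite inv; have m1 : (minn m L)%:R <= L%:R :> R by rewrite ler_nat geq_minr.
  have oc0 : 0 <= osc_cost.
    have /andP[_ H] := piN_bounds v.
    have d0 : 0 <= delta'.
      by have := le_trans p0 H; rewrite pmulr_lge0// invr_gt0.
    by rewrite addr_ge0// divr_ge0// ltW.
  have := ler_wpM2l oc0 m1; lra.
Qed.

(** Settled sites are distinct, so those below [y] cost at most [D] in total and number at most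
    [N * y]. The remaining [N * w] or more each contribute [1 + piN v / 2], which is at least
    [expR (delta / (4 N))]. *)
Lemma inner_product (v : G) (y w : nat) (D : R) (psi : S -> R) (dev : nat -> G -> R)
    (s : seq S) :
  (0 < y)%N -> (forall x, 0 <= psi x) ->
  (forall x, x != (v, y%:Z) -> y%:Z <= x.2 -> psi x = 1 + piN R v / 2) ->
  (forall j u, (0 < j)%N -> 1 - dev j u / 2 <= psi (u, y%:Z - j%:Z)) ->
  (forall j u, 0 <= dev j u <= 1) ->
  (forall m, \sum_(j < m) \sum_(u : G) dev j u <= D) ->
  uniq s -> (forall x, x \in s -> 0 < x.2) -> (v, y%:Z) \notin s ->
  (N * (y + w) <= size s)%N ->
  expR (delta / 4 * w%:R - D) <= \prod_(x <- s) psi x.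
Proof.
move=> y0 psi0 high low dev01 sumD us pos vs sz.
pose a (x : S) := x.2 < y%:Z.
pose sites : seq S := [seq (u, y%:Z - j%:Z) | u <- enum G, j <- iota 1 y.-1].
have Np := card_vertex_gt0 v.
have lowsites : {subset [seq x <- s | a x] <= sites}.
  move=> [u k]; rewrite mem_filter /a /= => /andP[ky ks].
  have k0 := pos _ ks; rewrite /= in k0.
  apply/allpairsP; exists (u, `|(y%:Z - k)%R|%N); split; rewrite ?mem_enum//=.
    rewrite mem_iota; lia.
  by congr (_, _); lia.
have usites : uniq sites.
  apply: allpairs_uniq; rewrite ?enum_uniq ?iota_uniq//.
  move=> [u j] [u' j'] _ _ /= [-> e]; congr (_, _); lia.
have cnt : (N * w <= size [seq x <- s | ~~ a x])%N.
  have := uniq_leq_size (filter_uniq a us) lowsites.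
  rewrite size_allpairs -cardE size_iota => c1.
  have : (size [seq x <- s | a x] + size [seq x <- s | ~~ a x])%N = size s.
    by rewrite !size_filter count_predC.
  have c2 := leq_mul (leqnn N) (leq_pred y); rewrite mulnDr in sz => e.
  rewrite -(leq_add2l (N * y)); apply: leq_trans sz _.
  by rewrite -e leq_add2r (leq_trans c1 c2).
rewrite (bigID a) /= [leRHS]mulrC; apply: (@le_trans _ _ (expR (delta / 4 * w%:R) * expR (- D))).
  by rewrite -expRD.
apply: ler_pM; rewrite ?expR_ge0//.
- rewrite -big_filter; set s' := [seq x <- s | ~~ a x].
  have -> : \prod_(x <- s') psi x = (1 + piN R v / 2) ^+ size s'.
    rewrite (eq_big_seq (fun=> 1 + piN R v / 2)); last first.
      move=> x; rewrite mem_filter /a -leNgt => /andP[yx xs]; apply: high => //.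
      by apply: contraNneq vs => <-.
    by rewrite big_const_seq count_predT iter_mulr_1.
  have p0 := piN_ge0 R v; have p1 := piN_le1 v.
  apply: (@le_trans _ _ (expR (piN R v / 2 / 2) ^+ (N * w))).
    rewrite -expRM_natl ler_expR natrM.
    have /andP[h _] := piN_bounds v; rewrite ler_pdivrMr// in h.
    have w0 : 0 <= w%:R :> R by [].
    have := ler_wpM2r w0 h; lra.
  apply: (@le_trans _ _ ((1 + piN R v / 2) ^+ (N * w))).
    apply: lerXn2r; rewrite ?nnegrE ?expR_ge0//; first lra.
    by apply: expR_half_le; lra.
  by apply: ler_weXn2l => //; lra.
- rewrite -big_filter; set s' := [seq x <- s | a x].
  pose dv (x : S) := dev `|(y%:Z - x.2)%R|%N x.1.
  apply: (@le_trans _ _ (\prod_(x <- s') expR (- dv x))); last first.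
    rewrite big_seq [leRHS]big_seq; apply: ler_prod => x xs.
    rewrite expR_ge0 /=; have [d0 d1] := andP (dev01 `|(y%:Z - x.2)%R|%N x.1).
    apply: le_trans (expRN_le d0 d1) _.
    have {xs} /allpairsP[[u j] [_ + ->]] := lowsites x xs.
    rewrite mem_iota /= => /andP[j1 _].
    rewrite (_ : `|(y%:Z - (y%:Z - j%:Z))%R|%N = j); last by lia.
    exact: low.
  have -> : \prod_(x <- s') expR (- dv x) = expR (- \sum_(x <- s') dv x).
    elim: s' => [|x s' IH]; first by rewrite !big_nil oppr0 expR0.
    by rewrite !big_cons IH -expRD opprD.
  rewrite ler_expR lerN2; apply: le_trans (sumD y).
  have dv0 x : 0 <= dv x by case/andP: (dev01 `|(y%:Z - x.2)%R|%N x.1).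
  apply: (@le_trans _ _ (\sum_(x <- sites) dv x)).
    by apply: sum_subseq_le => //; rewrite filter_uniq.
  rewrite /sites big_allpairs_dep /= big_enum /= exchange_big /=.
  have -> : \sum_(j < y) \sum_(u : G) dev j u =
    \sum_(0 <= j < y) \sum_(u : G) dev j u by rewrite big_mkord.
  rewrite big_ltn// -[leLHS]add0r lerD//.
    by apply: sumr_ge0 => u _; case/andP: (dev01 0%N u).
  rewrite /index_iota subn1 le_eqVlt; apply/orP; left; apply/eqP.
  apply: eq_bigr => j _; apply: eq_bigr => u _; congr (dev _ u) => /=; lia.
Qed.

End InnerBarrier.

(** * Outer bound *)

Section OuterBarrier.
Context (R : realType) (G : sgraph) (tau : nat) (delta' : R).
Local Notation S := (G * int)%type.
Local Notation N := #|G|.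
Hypothesis deg_gt0 : forall v : G, (0 < deg v)%N.
Hypothesis tau_gt0 : (0 < tau)%N.
Hypothesis tau_mix : forall v w : G,
  tv_dist (lazy_law R tau v) (lazy_law R tau w) <= 2^-1.
Hypothesis sum_pi1 : \sum_(v : G) piN R v = 1.
Hypothesis delta'_gt0 : 0 < delta'.
Hypothesis piN_le : forall v : G, piN R v <= delta' / N%:R.
Implicit Types (g : S -> R) (x z : S) (s : seq S).

Definition sparse s (l : nat) : Prop :=
  \sum_(u : G) piN R u * ((u, l%:Z) \in s)%:R <= 2^-1.

(* Each sparse level is crossed with probability at most 3/4, wherever the walk
   was [L] levels below. *)
Lemma outer_supersolution s (L K n b : nat) :
  2 * level_rate R tau ^+ L <= 4^-1 ->
  (forall i, (i < n)%N -> exists2 l : nat,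
     (b + i * K + L < l <= b + i.+1 * K)%N & sparse s l) ->
  exists g : S -> R,
    [/\ forall x, 0 <= g x <= 1,
        forall x, conf R s x -> cyl_avg g x <= g x,
        forall x, (b + n * K)%N%:Z < x.2 -> g x = 1
      & forall x, x.2 <= b.+1%:Z -> g x <= (3 / 4) ^+ n].
Proof.
move=> HL; elim: n b => [|n IH] b Hs.
  exists (fun=> 1); split => //; first by move=> x; rewrite ler01 lexx.
  by move=> x _; rewrite cyl_avg_cst.
(* The induction supplies a supersolution for the upper [n] blocks; the lowest block adds one sparse
   level [l]. *)
have [|g' [g'01 g'sup g'top g'bot]] := IH (b + K)%N.
  by move=> i iln; rewrite -!addnA [(K + (_ + _))%N]addnA -!mulSn addnA; exact: Hs.
have [l] := Hs 0%N isT; rewrite mul0n addn0 mul1n => /andP[l1 l2] ls.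
pose f (u : G) : R := ((u, l%:Z) \in s)%:R.
have f01 u : 0 <= f u <= 1 by rewrite /f; case: (_ \in _); rewrite ?ler01 ?lexx.
have [h [h0 h01 hrec hmean hosc]] := harmonic_extension deg_gt0 tau_gt0 tau_mix f01.
pose c : R := (3 / 4) ^+ n.
have c0 : 0 <= c by rewrite exprn_ge0//; lra.
have c1 : c <= 1 by rewrite exprn_ile1//; lra.
(* [q] bounds the chance of crossing level [l] through a settled site and then the upper blocks. *)
pose q x := if x.2 <= l%:Z then c * h `|(l%:Z - x.2)%R|%N x.1 else 1.
pose g x := Num.min (g' x) (q x).
have q0 x : 0 <= q x.
  by rewrite /q; case: ifP => // _; rewrite mulr_ge0//; case/andP: (h01 `|(l%:Z - x.2)%R|%N x.1).
have gg' x : g x <= g' x by rewrite ge_min lexx.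
have gq x : g x <= q x by rewrite ge_min lexx orbT.
have avgg' x : conf R s x -> cyl_avg g x <= g' x.
  by move=> sx; apply: le_trans (cyl_avg_le _ gg') _; exact: g'sup.
exists g; split.
- move=> x; rewrite le_min q0 andbT; case/andP: (g'01 x) => -> /= ?.
  exact: le_trans (gg' x) _.
- move=> x sx; rewrite le_min avgg'//=.
  have [xl|lx] := ltP x.2 l%:Z.
    apply: le_trans (cyl_avg_le _ gq) _.
    rewrite le_eqVlt; apply/orP; left; apply/eqP; case: x {sx} xl => u k /= kl.
    have [i ki] : exists i : nat, k = l%:Z - i.+1%:Z.
      by exists `|(l%:Z - k - 1)%R|%N; lia.
    have e1 : `|(l%:Z - k)%R|%N = i.+1 by lia.
    have e2 : `|(l%:Z - (k + 1))%R|%N = i by lia.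
    have e3 : `|(l%:Z - (k - 1))%R|%N = i.+2 by lia.
    have l'1 : k <= l%:Z by lia.
    have l'2 : k + 1 <= l%:Z by lia.
    have l'3 : k - 1 <= l%:Z by lia.
    rewrite /cyl_avg /q /= l'1 l'2 l'3 e1 e2 e3 lazy_opZ [in RHS]hrec.
    by ring.
  (* On level [l] a site of the aggregate is settled, so [q] equals [c] there, and [g'bot] gives
     [g' <= c]. Vacant sites, where [q] vanishes, need no inequality. *)
  apply: le_trans (avgg' _ sx) _; rewrite /q; case: ifPn => [xl|_].
    have ex : x.2 = l%:Z by apply/eqP; rewrite eq_le xl lx.
    rewrite ex subrr h0 /f; case: sx => [|/= xs].
      by rewrite /half_cylinder /= lerz0; lia.
    rewrite -ex -surjective_pairing xs mulr1; apply: g'bot.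
    by rewrite ex; lia.
  by case/andP: (g'01 x).
- move=> x hx; rewrite /g g'top; last by rewrite -addnA -mulSn.
  rewrite /q ifF ?minxx//; apply/negbTE; rewrite -ltNge; apply: le_lt_trans hx.
  by rewrite lez_nat mulSn; lia.
- move=> x xb; apply: le_trans (gq x) _.
  rewrite /q ifT; last by lia.
  (* From [l > b + L] and [x.2 <= b + 1] the distance is at least [L]. Then [h] exceeds its mean, at
     most 1/2 by sparsity, by at most 1/4: hence 3/4. *)
  have [j jE Lj] : exists2 j : nat, `|(l%:Z - x.2)%R|%N = j & (L <= j)%N.
    by exists `|(l%:Z - x.2)%R|%N => //; lia.
  rewrite jE exprSr; apply: ler_wpM2l => //.
  have [r12 r1] := andP (level_rate_bounds R tau_gt0).
  have rj : 2 * level_rate R tau ^+ j <= 4^-1.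
    apply: le_trans HL; rewrite ler_wpM2l//.
    by rewrite ler_wiXn2l//; lra.
  have hj : h j x.1 = \sum_(w : G) piN R w * h j x.1.
    by rewrite -mulr_suml sum_pi1 mul1r.
  have : h j x.1 <= \sum_(w : G) (piN R w * h j w + piN R w * 4^-1).
    rewrite [leLHS]hj; apply: ler_sum => w _; rewrite -mulrDr ler_wpM2l ?piN_ge0//.
    have := hosc j x.1 w; lra.
  rewrite big_split /= -mulr_suml sum_pi1 hmean mul1r.
  have := ls; rewrite /sparse -/(f _) => H1 H2.
  apply: le_trans H2 _; apply: (@le_trans _ _ (2^-1 + 4^-1)); last by lra.
  by rewrite lerD2r.
Qed.

Lemma sum_levels_le s (a M : nat) :
  (\sum_(j < M) \sum_(u : G) ((u, Posz (a + j.+1)) \in s) <=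
   size [seq x <- s | (a%:Z < x.2)%R])%N.
Proof.
pose sites : seq S := [seq (u, (a + j.+1)%N%:Z) | u <- enum G, j <- iota 0 M].
have usites : uniq sites.
  apply: allpairs_uniq; rewrite ?enum_uniq ?iota_uniq//.
  move=> [u j] [u' j'] _ _ /= [-> e]; congr (_, _); lia.
have -> : (\sum_(j < M) \sum_(u : G) ((u, Posz (a + j.+1)) \in s) =
    size [seq x <- sites | x \in s])%N.
  rewrite size_filter -sum1_count [RHS]big_mkcond /= /sites big_allpairs_dep /= big_enum /=.
  rewrite [RHS]exchange_big /=.
  rewrite -(big_mkord xpredT (fun j => \sum_(u : G) ((u, Posz (a + j.+1)) \in s))%N).
  rewrite /index_iota subn0.
  by apply: eq_bigr => j _; apply: eq_bigr => u _; case: (_ \in s).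
apply: uniq_leq_size; first by rewrite filter_uniq.
move=> x; rewrite !mem_filter => /andP[xs /allpairsP[[u j] [_ _ xE]]].
by rewrite xs andbT xE /=; lia.
Qed.

(** A level that is not sparse has at least [N / (2 delta')] settled sites; [M] such levels would
    need more sites than there are above [b]. *)
Lemma exists_sparse s (a b M : nat) : (0 < N)%N -> (b <= a)%N ->
  2 * delta' * (size [seq x <- s | b%:Z < x.2])%:R < (N * M)%:R ->
  exists2 l : nat, (a < l <= a + M)%N & sparse s l.
Proof.
move=> N0 ba H; apply: contrapT => ns.
have dense j : (j < M)%N ->
    N%:R <= 2 * delta' * \sum_(u : G) ((u, (a + j.+1)%N%:Z) \in s)%:R.
  move=> jM; have : 2^-1 < \sum_(u : G) piN R u * ((u, (a + j.+1)%N%:Z) \in s)%:R.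
    rewrite ltNge; apply/negP => h; apply: ns; exists (a + j.+1)%N => //; lia.
  have : \sum_(u : G) piN R u * ((u, (a + j.+1)%N%:Z) \in s)%:R <=
     \sum_(u : G) delta' / N%:R * ((u, (a + j.+1)%N%:Z) \in s)%:R.
    by apply: ler_sum => u _; rewrite ler_wpM2r.
  rewrite -mulr_sumr => h1 h2; have := lt_le_trans h2 h1.
  rewrite mulrAC ltr_pdivlMr ?ltr0n//; lra.
have : \sum_(j < M) (N%:R : R) <=
    \sum_(j < M) (2 * delta' * \sum_(u : G) ((u, (a + j.+1)%N%:Z) \in s)%:R).
  by apply: ler_sum => j _; exact: dense.
rewrite sumr_const card_ord -mulr_sumr.
have -> : \sum_(j < M) \sum_(u : G) ((u, (a + j.+1)%N%:Z) \in s)%:R =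
    ((\sum_(j < M) \sum_(u : G) ((u, Posz (a + j.+1)) \in s))%N)%:R :> R.
  by rewrite natr_sum; apply: eq_bigr => j _; rewrite natr_sum.
have le1 : ((\sum_(j < M) \sum_(u : G) ((u, Posz (a + j.+1)) \in s))%N)%:R <=
    (size [seq x <- s | b%:Z < x.2])%:R :> R.
  rewrite ler_nat; apply: leq_trans (sum_levels_le s a M) _.
  rewrite !size_filter; apply: sub_count => x /=; lia.
move=> H2; have : 2 * delta' * ((\sum_(j < M) \sum_(u : G) ((u, Posz (a + j.+1)) \in s))%N)%:R
    <= 2 * delta' * (size [seq x <- s | b%:Z < x.2])%:R.
  by rewrite ler_wpM2l// mulr_ge0// ltW.
move=> H3; have := le_lt_trans (le_trans H2 H3) H.
by rewrite natrM mulr_natr ltxx.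
Qed.

(** The subtraction is truncated, so the condition is void until [size s %/ N] exceeds [w]. *)
Definition filled (w : nat) s : Prop :=
  forall x, 0 < x.2 -> x.2 <= (size s %/ N - w)%N%:Z -> x \in s.

(** The filled levels use up [N * (size s %/ N - w)] particles; the extra 1 in [w.+1] covers the
    remainder of the division. *)
Lemma filled_top_size w s : (0 < N)%N -> filled w s ->
  (size [seq x <- s | ((size s %/ N - w)%N%:Z < x.2)%R] <= N * w.+1)%N.
Proof.
move=> N0; rewrite /filled; set k0 := (size s %/ N - w)%N => fs.
pose sites : seq S := [seq (u, j%:Z) | u <- enum G, j <- iota 1 k0].
have usites : uniq sites.
  by apply: allpairs_uniq; rewrite ?enum_uniq ?iota_uniq// => -[u j] [u' j'] _ _ /= [-> ->].
have sub : {subset sites <= [seq x <- s | ~~ (k0%:Z < x.2)]}.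
  move=> x /allpairsP[[u j] [_ + ->]]; rewrite mem_iota mem_filter /= => jk.
  apply/andP; split; first lia.
  by apply: fs => /=; lia.
have := uniq_leq_size usites sub; rewrite size_allpairs -cardE size_iota => c1.
have c2 : (size [seq x <- s | (k0%:Z < x.2)%R] +
           size [seq x <- s | ~~ (k0%:Z < x.2)%R])%N = size s.
  by rewrite !size_filter count_predC.
have c3 := ltn_ceil (size s) N0.
have c4 : ((size s %/ N).+1 * N <= N * k0 + N * w.+1)%N.
  by rewrite -mulnDr mulnC leq_mul2l /k0; lia.
rewrite -(leq_add2r (N * k0)) [X in (_ <= X)%N]addnC.
apply: leq_trans c4; apply: leq_trans (ltnW c3); rewrite -c2 leq_add2l.
exact: c1.
Qed.

Context d (Omega : measurableType d) (P : probability Omega R).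
Context (X : nat -> Omega -> S).
Hypothesis mc : markov_chain P (@cyl_start R G) (@cyl_step R G) X.

(** A block consists of [L] levels for mixing followed by [M] levels, among which [exists_sparse]
    finds a sparse one. The walk starts at level 0, below all blocks. *)
Lemma outer_exit_le s (w L M n : nat) : (0 < N)%N ->
  2 * level_rate R tau ^+ L <= 4^-1 -> 2 * delta' * w.+1%:R < M%:R -> filled w s ->
  (\esum_(z in [set z : S | ((size s %/ N - w + n * (L + M))%N%:Z < z.2)%R])
     P (exit_at X (conf R s) z) <= ((3 / 4) ^+ n)%:E)%E.
Proof.
move=> N0 HL HM fs; set b := (size s %/ N - w)%N.
have [|g [g01 gsup gtop gbot]] := @outer_supersolution s L (L + M) n b HL.
  move=> i _; have [||l lE ls] := @exists_sparse s (b + i * (L + M) + L) b M N0.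
  - by rewrite -addnA leq_addr.
  - have := filled_top_size N0 fs; rewrite -/b -(ler_nat R) => H.
    apply: (@le_lt_trans _ _ (2 * delta' * (N * w.+1)%:R)).
      by rewrite ler_wpM2l// mulr_ge0// ltW.
    rewrite !natrM mulrCA ltr_pM2l ?ltr0n//.
  - exists l => //; move: lE; rewrite mulSn; lia.
have g0 x : 0 <= g x by case/andP: (g01 x).
have := cyl_exit_superharmonic mc g0 gsup.
move=> H; apply: (@le_trans _ _ (\sum_(v : G) piN R v * g (v, 0))%:E); last first.
  rewrite lee_fin; apply: (@le_trans _ _ (\sum_(v : G) piN R v * (3 / 4) ^+ n)).
    by apply: ler_sum => v _; rewrite ler_wpM2l ?piN_ge0// gbot.
  by rewrite -mulr_suml sum_pi1 mul1r.
apply: le_trans H; rewrite [leRHS](esumID [set z | (b + n * (L + M))%N%:Z < z.2]).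
  rewrite setTI -[leLHS]adde0; apply: leeD.
    by apply: le_esum => z /= hz; rewrite gtop// mule1.
  by apply: esum_ge0 => z _; rewrite mule_ge0// lee_fin.
by move=> z _; rewrite mule_ge0// lee_fin.
Qed.

End OuterBarrier.

(** * Union bound *)

Section Fluctuations.
Context (R : realType) (G : sgraph) (tau : nat) (delta delta' : R).
Local Notation S := (G * int)%type.
Local Notation N := #|G|.
Hypothesis deg_gt0 : forall v : G, (0 < deg v)%N.
Hypothesis tau_gt0 : (0 < tau)%N.
Hypothesis tau_mix : forall v w : G,
  tv_dist (lazy_law R tau v) (lazy_law R tau w) <= 2^-1.
Hypothesis card_gt0 : (0 < N)%N.
Hypothesis delta_gt0 : 0 < delta.
Hypothesis delta'_gt0 : 0 < delta'.
Hypothesis piN_bounds : forall v : G, delta / N%:R <= piN R v <= delta' / N%:R.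

Lemma probability_bigsetU_le d (T : measurableType d) (P : probability T R)
    (I : Type) (r : seq I) (F : I -> set T) (e : R) :
  (forall i, measurable (F i)) -> (forall i, (P (F i) <= e%:E)%E) ->
  (P (\big[setU/set0]_(i <- r) F i) <= ((size r)%:R * e)%:E)%E.
Proof.
move=> mF Fe; have mU (t : seq I) : measurable (\big[setU/set0]_(i <- t) F i).
  by elim: t => [|i t IH]; rewrite ?big_nil ?big_cons//; exact: measurableU.
elim: r => [|i r IH]; first by rewrite big_nil measure0 mul0r.
rewrite big_cons; apply: le_trans (measureU2 _ (mF i) (mU r)) _.
rewrite /= -natr1 mulrDl mul1r EFinD addeC; exact: leeD.
Qed.

Context d (Omega : measurableType d) (P : probability Omega R).
Context (X : nat -> nat -> Omega -> S) (A : nat -> Omega -> set S).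
Hypothesis mc : forall t, markov_chain P (@cyl_start R G) (@cyl_step R G) (X t).
Hypothesis indep : mutually_independent P (fun t => generated_sigma (X t)).
Hypothesis A0 : forall w, A 0%N w = half_cylinder (0 : R).
Hypothesis AS : forall t w, A t.+1 w = A t w `|` first_exit (A t w) (fun k => X t k w).

Let mX t k x : measurable (X t k @^-1` [set x]).
Proof. by case: (mc t). Qed.

Let sum_pi1 : \sum_(v : G) piN R v = 1.
Proof. exact: sum_piN (mc 0). Qed.

Lemma missed_le t (v : G) (y w L : nat) : (0 < y)%N -> (N * (y + w) <= t)%N ->
  N%:R * level_rate R tau ^+ L <= 1 ->
  (P (missed R X t (v, y%:Z)) <=
   (expR (osc_cost delta delta' * L%:R + 4 * Num.sqrt tau%:R - delta / 4 * w%:R))%:E)%E.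
Proof.
move=> y0 yt HL.
have [psi [dev [psi0 psiv sup start [high low dev01 sumD]]]] :=
  inner_supersolution deg_gt0 tau_gt0 tau_mix sum_pi1 delta_gt0 piN_bounds v y0 HL.
rewrite -opprB expRN; apply: (probability_missed mc indep psi0 psiv).
- exact: expR_gt0.
- move=> s vs; apply: le_trans (cyl_exit_superharmonic (mc _) psi0 _) _; last first.
    by rewrite lee_fin.
  move=> x sx; apply: sup; apply: contraPneq sx => ->; case => [|/= h].
    by rewrite /half_cylinder /= lerz0; lia.
  by rewrite h in vs.
- move=> s w0 st vs hs; have [us pos] := hist_uniq hs.
  apply: (inner_product tau_gt0 sum_pi1 delta_gt0 piN_bounds y0 psi0 high low dev01 sumD us pos vs).
  by rewrite st.
Qed.

Lemma jumped_le t (w L M n : nat) :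
  2 * level_rate R tau ^+ L <= 4^-1 -> 2 * delta' * w.+1%:R < M%:R ->
  (P (jumped R X t (filled w)
        [set z : S | ((t %/ N - w + n * (L + M))%N%:Z < z.2)%R]) <=
   ((3 / 4) ^+ n)%:E)%E.
Proof.
move=> HL HM; apply: (probability_jumped mc indep); first by rewrite exprn_ge0//; lra.
move=> s w0 st fs _; rewrite -st.
have ple (v : G) : piN R v <= delta' / N%:R by case/andP: (piN_bounds v).
exact: (outer_exit_le deg_gt0 tau_gt0 tau_mix sum_pi1 delta'_gt0 ple (mc _) n card_gt0 HL HM fs).
Qed.

(** Induction along the recursion for [A]: a new site is decomposed according to the time at which
    the walk first visits it. The complement rule in the union bound relies on this. *)
Lemma measurable_aggregate t x : measurable [set w | A t w x].
Proof.
elim: t x => [|t IH] x.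
  have [h|h] := pselect (half_cylinder (0 : R) x).
    rewrite (_ : [set w | _] = setT)//; apply/seteqP; split => // w _ /=.
    by rewrite A0.
  rewrite (_ : [set w | _] = set0)//; apply/seteqP; split => // w /=.
  by rewrite A0.
have inA k : measurable [set w | A t w (X t k w)].
  rewrite (_ : [set w | _] =
    \bigcup_(z in [set: S]) (X t k @^-1` [set z] `&` [set w | A t w z])).
    by apply: measurable_countable_bigcup => z _; exact: measurableI.
  apply/seteqP; split => [w Aw|w [z _ [/= -> ?]]]//.
  by exists (X t k w).
have inAn n : measurable [set w | forall k, (k < n)%N -> A t w (X t k w)].
  rewrite (_ : [set w | _] = \bigcap_(k in `I_n) [set w | A t w (X t k w)]).
    by apply: bigcap_measurableType => k _.
  by apply/seteqP; split.
rewrite (_ : [set w | _] = [set w | A t w x] `|`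
   \bigcup_n (X t n @^-1` [set x] `&` ~` [set w | A t w x] `&`
     [set w | forall k, (k < n)%N -> A t w (X t k w)])).
  apply: measurableU => //; apply: bigcupT_measurable => n.
  by apply: measurableI => //; apply: measurableI => //; exact: measurableC.
apply/seteqP; split => w /=; rewrite AS.
  move=> [h|[n [nx nA h]]]; [by left|right]; exists n => //; split => //; split => //.
move=> [h|[n _ [[nx nA] h]]]; [by left|right]; exists n; split => //.
Qed.

Lemma measurable_sandwich t (lo hi : set S) :
  measurable [set w | lo `<=` A t w /\ A t w `<=` hi].
Proof.
rewrite (_ : [set w | _] = ~` (\bigcup_(x in lo) (~` [set w | A t w x]) `|`
   \bigcup_(x in ~` hi) [set w | A t w x])).
  apply: measurableC; apply: measurableU; apply: measurable_countable_bigcup => x _.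
    by apply: measurableC; exact: measurable_aggregate.
  exact: measurable_aggregate.
apply/seteqP; split => w /=.
  by move=> [h1 h2] [[x lx]|[x hx]] /=; [apply; exact: h1|move/h2].
move=> h; split => x.
  by move=> lx; apply: contrapT => nA; apply: h; left; exists x.
by move=> Ax; apply: contrapT => nh; apply: h; right; exists x.
Qed.

(** Off the null event [lost], a failure of either inclusion forces a vacant low site or a jump far
    above a filled configuration. *)
Lemma sandwich_ge T (lo hi : set S) (w L M n : nat) (e1 e2 : R) :
  N%:R * level_rate R tau ^+ L <= 1 ->
  2 * level_rate R tau ^+ L <= 4^-1 -> 2 * delta' * w.+1%:R < M%:R ->
  expR (osc_cost delta delta' * L%:R + 4 * Num.sqrt tau%:R - delta / 4 * w%:R) <= e1 ->
  (3 / 4) ^+ n <= e2 ->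
  (forall z, lo z -> z.2 <= (T %/ N)%N%:Z - w%:Z) ->
  (forall z, z.2 <= (T %/ N + n * (L + M))%N%:Z -> hi z) ->
  ((1 - ((T.+1 * (N * T.+1))%:R * e1 + T%:R * e2))%:E <=
   P [set x | lo `<=` A T x /\ A T x `<=` hi])%E.
Proof.
move=> HL HL2 HM He1 He2 Hlo Hhi; set E := [set x | _].
have mE : measurable E by exact: measurable_sandwich.
have e1_0 : 0 <= e1 by rewrite (le_trans _ He1)// expR_ge0.
(* Irrelevant triples get the empty event, so the union runs over a full box that is easy to
   count. *)
pose Fm (i : nat * (G * nat)) :=
  if (0 < i.2.2)%N && (N * (i.2.2 + w) <= i.1)%N
  then missed R X i.1 (i.2.1, i.2.2%:Z) else set0.
pose rm := [seq (t, uy) | t <- iota 0 T.+1,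
              uy <- [seq (u, y) | u <- enum G, y <- iota 0 T.+1]].
pose Fj t := jumped R X t (filled w)
   [set z : S | ((t %/ N - w + n * (L + M))%N%:Z < z.2)%R].
pose Bm := \big[setU/set0]_(i <- rm) Fm i.
pose Bj := \big[setU/set0]_(t <- iota 0 T) Fj t.
have mFm i : measurable (Fm i).
  by rewrite /Fm; case: ifP => // _; exact: measurable_missed.
have mFj t : measurable (Fj t) by exact: measurable_jumped.
have mBm : measurable Bm.
  by rewrite /Bm -bigcup_seq; apply: measurable_countable_bigcup.
have mBj : measurable Bj.
  by rewrite /Bj -bigcup_seq; apply: measurable_countable_bigcup.
have mlost : measurable (lost R X) by exact: measurable_lost.
have PBm : (P Bm <= ((T.+1 * (N * T.+1))%:R * e1)%:E)%E.
  have sz : size rm = (T.+1 * (N * T.+1))%N.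
    by rewrite !size_allpairs !size_iota -cardE.
  rewrite -sz; apply: probability_bigsetU_le => // i.
  rewrite /Fm; case: ifP => [/andP[y0 yt]|_]; last by rewrite measure0 lee_fin.
  by apply: le_trans (missed_le _ y0 yt HL) _; rewrite lee_fin.
have PBj : (P Bj <= (T%:R * e2)%:E)%E.
  rewrite -[T in T%:R](size_iota 0); apply: probability_bigsetU_le => // t.
  by apply: le_trans (jumped_le _ _ HL2 HM) _; rewrite lee_fin.
have sub : ~` E `<=` lost R X `|` (Bm `|` Bj).
  move=> x nE; apply: contrapT => /not_orP[nl /not_orP[nm nj]]; apply: nE.
  have [s sT hs] := histP T nl.
  have AT : A T x = conf R s by rewrite -sT; exact: hist_aggregate.
  (* A vacant site at level [y <= size s' %/ N - w] satisfies [N * (y + w) <= size s'], so it would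
     realise one of the events in [Bm]. *)
  have fill s' : hist R X s' x -> (size s' <= T)%N -> filled w s'.
    move=> hs' s'T [u [y|//]] /= y0 yt; rewrite ltz_nat in y0; rewrite lez_nat in yt.
    apply: contrapT => /negP ns'; apply: nm.
    rewrite /Bm -bigcup_seq; exists (size s', (u, y)).
      apply/allpairsP; exists (size s', (u, y)).
      split; [by rewrite mem_iota add0n ltnS| |by []].
      apply/allpairsP; exists (u, y); split; rewrite ?mem_enum//.
      rewrite mem_iota add0n ltnS; apply: leq_trans s'T; apply: leq_trans (leq_div _ N).
      exact: leq_trans yt (leq_subr _ _).
    rewrite /Fm /= ifT; first by exists s'.
    have ws : (w <= size s' %/ N)%N by rewrite ltnW// -subn_gt0 (leq_trans y0 yt).
    by rewrite y0 /= mulnC -leq_divRL// addnC -leq_subRL.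
  rewrite /E /= AT; split => z.
    move=> /Hlo zl; have [z0|z0] := leP z.2 0.
      by left; rewrite /half_cylinder /= lerz0.
    right => /=; apply: (fill s hs); rewrite ?sT//.
    case: z z0 zl => u [y|//] /= _; rewrite lerBrDr -PoszD !lez_nat => yw.
    by rewrite leq_subRL ?(leq_trans (leq_addl y w) yw)// addnC.
  move=> Az; apply: Hhi; case: Az => [|/= zs].
    by rewrite /half_cylinder /= lerz0 => /le_trans; apply.
  (* The most recent sites come first, so [s2] is the history at the moment when the particle that
     settles at [z] is released. *)
  move: hs sT; case/splitPr: zs => s1 s2 hs sT.
  have hz := hist_drop (size s1) hs; rewrite drop_size_cat// in hz.
  have s2T : (size s2 < T)%N by rewrite -sT size_cat /= addnS ltnS leq_addl.
  have hs2 : hist R X s2 x by case: hz.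
  have : z.2 <= (size s2 %/ N - w + n * (L + M))%N%:Z.
    rewrite leNgt; apply/negP => zh; apply: nj; rewrite /Bj -bigcup_seq.
    exists (size s2) => /=; first by rewrite mem_iota add0n.
    exists (s2, z) => //; split => //=; split => //.
    by apply: fill => //; exact: ltnW.
  have := leq_div2r N (ltnW s2T).
  move: (n * _)%N (size s2 %/ N)%N (T %/ N)%N => c a b ab /le_trans; apply.
  by rewrite lez_nat leq_add2r (leq_trans (leq_subr _ _)).
rewrite -[E]setCK probability_setC; last exact: measurableC.
have PnE : (P (~` E) <= ((T.+1 * (N * T.+1))%:R * e1 + T%:R * e2)%:E)%E.
  apply: (@le_trans _ _ (P (lost R X `|` (Bm `|` Bj)))).
    apply: le_measure; rewrite ?inE//; first exact: measurableC.
    by apply: measurableU => //; exact: measurableU.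
  apply: le_trans (measureU2 _ mlost (measurableU _ _ mBm mBj)) _.
  have /eqP := probability_lost mc deg_gt0; rewrite eq_le => /andP[Pl _].
  rewrite -[leRHS]add0e; apply: leeD; first exact: Pl.
  by apply: le_trans (measureU2 _ mBm mBj) _; rewrite EFinD; exact: leeD.
by rewrite EFinB; exact: leeB.
Qed.

End Fluctuations.

(** * Choice of constants *)

Lemma level_rate_exp (R : realType) (tau L : nat) (l : R) : (0 < tau)%N ->
  2 * Num.sqrt tau%:R * l <= L%:R -> level_rate R tau ^+ L <= expR (- l).
Proof.
move=> t0 H; have [r12 r1] := andP (level_rate_bounds R t0).
have s1 := sqrt_tau_ge1 R t0.
apply: (@le_trans _ _ (expR (- (2 * Num.sqrt tau%:R)^-1) ^+ L)).
  apply: lerXn2r; rewrite ?nnegrE ?expR_ge0//; first lra.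
  by rewrite /level_rate expR_ge1Dx.
rewrite -expRM_natl ler_expR mulrN lerN2 ler_pdivlMr; last lra.
by rewrite mulrC.
Qed.

Theorem theorem4 (R : realType) (delta delta' : R) (m : nat) (gamma : R) :
  0 < delta -> 0 < delta' -> 0 < gamma ->
  exists2 C : R, 0 < C &
  forall G : nat -> sgraph,
    (forall N, (0 < N)%N -> #|G N| = N /\ connected_graph (G N)) ->
    (forall N, (1 < N)%N -> forall v : G N,
       delta / N%:R <= piN R v <= delta' / N%:R) ->
  forall T : nat -> nat,
    (forall N, (0 < N)%N -> (T N <= N ^ m)%N) ->
  exists N0 : nat, forall N, (N0 <= N)%N ->
  forall (d : measure_display) (Omega : measurableType d)
    (P : probability Omega R) (A : nat -> Omega -> set (G N * int)),
    IDLA P (half_cylinder (0 : R)) A ->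
    let width := C * Num.sqrt (mixing_time (G N) (2^-1 : R)) * ln N%:R ^+ 2 in
    ((1 - N%:R `^ (- gamma))%:E <=
     P [set w | half_cylinder ((T N)%:R / N%:R - width) `<=` A (T N) w /\
                A (T N) w `<=` half_cylinder ((T N)%:R / N%:R + width)])%E.
Proof.
move=> d0 d'0 g0; pose oc := osc_cost delta delta'.
have oc0 : 0 < oc by rewrite addr_gt0// divr_gt0.
(* At most [N ^ (2 m + 4)] events, each of probability at most [N ^ (- K)], leave
   [N ^ (- gamma)]. *)
pose K : R := (2 * m + 4)%:R + gamma.
have K0 : 0 < K by rewrite ltr_wpDl.
(* With [La = sqrt tau * ln N], [cD * La] bounds the inner cost, as [L <= 3 La] and
   [sqrt tau <= La]; [cw] then makes the gain [delta / 4 * w] exceed it by [K * La]. *)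
pose cD := 3 * oc + 4; have cD0 : 0 < cD by rewrite /cD; lra.
pose cw := 4 / delta * (cD + K) + 1.
have q0 : 0 < 4 / delta * (cD + K).
  by apply: mulr_gt0; [exact: divr_gt0|exact: addr_gt0].
have cw1 : 1 <= cw by rewrite lerDr ltW.
pose cM := 2 * delta' * (cw + 1) + 2.
have cM0 : 0 < cM.
  have : 0 < delta' * (cw + 1) by rewrite mulr_gt0//; lra.
  by rewrite /cM; lra.
(* The product covers [n] blocks of [L + M] levels above; [cw + 1] covers the deficit [w] below and
   the rounding of [T / N]. *)
pose C := (4 * K + 1) * (3 + cM) + cw + 1.
have KM : 0 < (4 * K + 1) * (3 + cM) by rewrite mulr_gt0//; lra.
exists C; first by rewrite /C; lra.
(* From 8 on, [ln N >= 1] and [2 / N <= 1/4]. *)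
move=> G HG Hpi T HT; exists 8%N => N N8 d Omega P A [X [mc indep A0 AS]].
cbv zeta; set width := C * Num.sqrt (mixing_time _ _) * ln _ ^+ 2.
have Np : (0 < N)%N by exact: leq_trans N8.
have N1 : (1 < N)%N by exact: leq_trans N8.
have Nr : 0 < N%:R :> R by rewrite ltr0n.
have [cardN cG] := HG N Np.
have piB (v : G N) : delta / #|G N|%:R <= piN R v <= delta' / #|G N|%:R.
  by rewrite cardN; exact: Hpi.
have cN0 : (0 < #|G N|)%N by rewrite cardN.
have dg (v : G N) : (0 < deg v)%N.
  rewrite lt0n; apply/eqP => dv; have /andP[h _] := piB v.
  move: h; rewrite {1}/piN dv mul0r leNgt => /negP; apply.
  by rewrite divr_gt0// ltr0n.
have [tau tauE mix] := mixing_timeP R cG dg.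
have t0 : (0 < tau)%N.
  have /card_gt1P[u [v [_ _ uv]]] : (1 < #|G N|)%N by rewrite cardN.
  exact: mixing_time_gt0 uv (mix u v).
pose r : R := Num.sqrt tau%:R; have r1 : 1 <= r := sqrt_tau_ge1 R t0.
pose l : R := ln N%:R; have lE : expR l = N%:R by rewrite lnK.
have l1 : 1 <= l.
  rewrite -(expRK 1) ler_ln ?posrE ?expR_gt0//.
  by apply: (le_trans (expR1_le4 R)); rewrite ler_nat (leq_trans _ N8).
pose La := r * l; have La1 : 1 <= La by rewrite -[1]mulr1 ler_pM.
have [L /andP[L1 L2]] : exists L : nat, 2 * La <= L%:R <= 2 * La + 1.
  by apply: nat_ceil; lra.
have rateL : level_rate R tau ^+ L <= N%:R^-1.
  by rewrite -lE -expRN; apply: level_rate_exp; rewrite -?mulrA.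
have HL : #|G N|%:R * level_rate R tau ^+ L <= 1.
  by rewrite cardN -ler_pdivlMl// mulr1.
have HL2 : 2 * level_rate R tau ^+ L <= 4^-1.
  have : N%:R^-1 <= 8^-1 :> R by rewrite lef_pV2 ?posrE// ler_nat.
  lra.
have [w /andP[w1 w2]] : exists w : nat,
    4 / delta * (cD + K) * La <= w%:R <= 4 / delta * (cD + K) * La + 1.
  by apply: nat_ceil; rewrite mulr_ge0 ?(ltW q0)//; lra.
have wLa : w%:R <= cw * La.
  by apply: (le_trans w2); rewrite /cw; lra.
have [M /andP[M1 M2]] : exists M : nat,
    2 * delta' * w.+1%:R + 1 <= M%:R <= 2 * delta' * w.+1%:R + 1 + 1.
  by apply: nat_ceil; rewrite addr_ge0// mulr_ge0// mulr_ge0// ltW.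
have MLa : M%:R <= cM * La.
  apply: (le_trans M2); rewrite /cM -natr1.
  have h1 : w%:R + 1 <= (cw + 1) * La by lra.
  have h : 2 * delta' * (w%:R + 1) <= 2 * delta' * ((cw + 1) * La).
    by rewrite ler_wpM2l// mulr_ge0// ltW.
  lra.
have HM : 2 * delta' * w.+1%:R < M%:R by lra.
have [n /andP[n1 n2]] : exists n : nat, 4 * K * l <= n%:R <= 4 * K * l + 1.
  by apply: nat_ceil; rewrite mulr_ge0 ?mulr_ge0 ?(ltW K0)//; lra.
have He1 : expR (osc_cost delta delta' * L%:R + 4 * r - delta / 4 * w%:R)
    <= expR (- (K * l)).
  rewrite ler_expR -/oc.
  have h1 : oc * L%:R <= oc * (3 * La) by rewrite ler_wpM2l ?(ltW oc0)//; lra.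
  have h2 : r <= La by rewrite -[leLHS]mulr1 ler_wpM2l//; lra.
  have h3 : delta / 4 * (4 / delta * (cD + K) * La) <= delta / 4 * w%:R.
    by rewrite ler_wpM2l// divr_ge0// ltW.
  have h4 : delta / 4 * (4 / delta * (cD + K) * La) = (cD + K) * La.
    by field; rewrite gt_eqF.
  have h5 : K * l <= K * La.
    by rewrite ler_wpM2l ?(ltW K0)// /La -[leLHS]mul1r ler_wpM2r//; lra.
  rewrite h4 in h3; rewrite /cD in h3; lra.
(* Uses [3 / 4 <= expR (- 1 / 4)] and [n >= 4 K l]. *)
have He2 : (3 / 4) ^+ n <= expR (- (K * l)).
  apply: (@le_trans _ _ (expR (- 4^-1) ^+ n)).
    apply: lerXn2r; rewrite ?nnegrE ?expR_ge0//.
    by apply: le_trans (expR_ge1Dx _); lra.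
  rewrite -expRM_natl ler_expR; lra.
have widthE : width = C * (La * l) by rewrite /width tauE -/r -/l /La; ring.
have lala : La <= La * l by rewrite -[leLHS]mulr1 ler_wpM2l//; lra.
have lal0 : 0 <= La * l by lra.
have tr : (T N)%:R = (T N %/ N)%N%:R * N%:R + (T N %% N)%N%:R :> R.
  by rewrite {1}(divn_eq (T N) N) natrD natrM.
have mr : (T N %% N)%N%:R < N%:R :> R by rewrite ltr_nat ltn_pmod.
have tlo : (T N %/ N)%N%:R <= (T N)%:R / N%:R :> R.
  by rewrite ler_pdivlMr// tr lerDl.
have thi : (T N)%:R / N%:R < (T N %/ N)%N%:R + 1 :> R.
  by rewrite ltr_pdivrMr// tr mulrDl mul1r ltrD2l.
apply: le_trans (sandwich_ge dg t0 mix cN0 d0 d'0 piB mc indep A0 AS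
  HL HL2 HM He1 He2 _ _); last 2 first.
- move=> [v k] /=; rewrite /half_cylinder /= cardN widthE => H.
  (* [T / N] may exceed its integer part by almost 1; the strict inequality between integers removes
     this excess. *)
  have : k%:~R < ((T N %/ N)%N%:Z - w%:Z + 1)%:~R :> R.
    rewrite rmorphD rmorphB /= -!pmulrn; apply: (le_lt_trans H).
    have h : w%:R + 1 <= C * (La * l).
      apply: (@le_trans _ _ ((cw + 1) * (La * l))).
        have : (cw + 1) * La <= (cw + 1) * (La * l) by rewrite ler_wpM2l//; lra.
        by lra.
      rewrite ler_wpM2r// /C; lra.
    lra.
  by rewrite ltr_int ltzD1.
- move=> [v k] /=; rewrite /half_cylinder /= cardN widthE => H.
  have : k%:~R <= (T N %/ N + n * (L + M))%N%:Z%:~R :> R by rewrite ler_int.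
  rewrite -pmulrn natrD natrM => H2; apply: (le_trans H2).
  apply: lerD => //; rewrite natrD.
  apply: (@le_trans _ _ (((4 * K + 1) * l) * ((3 + cM) * La))).
    by apply: ler_pM => //; lra.
  have -> : (4 * K + 1) * l * ((3 + cM) * La) = (4 * K + 1) * (3 + cM) * (La * l) by ring.
  by rewrite ler_wpM2r// /C; lra.
rewrite lee_fin lerD2l lerN2 cardN -mulrDl -natrD.
have powE : N%:R `^ (- gamma) = expR (- (gamma * l)).
  by rewrite /powR gt_eqF// mulNr.
have cnt := event_count_le N1 (HT N Np).
apply: (@le_trans _ _ ((N ^ (2 * m + 4))%N%:R * expR (- (K * l)))).
  by rewrite ler_wpM2r ?expR_ge0// ler_nat.
rewrite powE natrX -lE -expRM_natl -expRD ler_expR /K; lra.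
Qed.
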